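(* Let $q\ge 8$ be even, $\mu\in\mathbb F_q^*\setminus\{1\}$, and let $\mathcal O_\mu$ be the $G_q$-orbit of $\ell_\mu$. Then $\Pi_\Gamma=\Lambda_\Gamma=P_{\mathcal C}=L_{\mathcal C}=0$ and $P_T=2$, $P_{3_\Gamma}=\tfrac13(q-3-N_1(\mu))$, $P_{1_\Gamma}=N_1(\mu)$, $P_{0_\Gamma}=\tfrac23(q-N_1(\mu))$; $L_T=q-1$, $L_{3_\Gamma}=q-3-N_1(\mu)$, $L_{1_\Gamma}=N_1(\mu)$, $L_{0_\Gamma}=q-N_1(\mu)$; $\Pi_{2_{\mathcal C}}=2$, $\Pi_{3_{\mathcal C}}=\tfrac13(q-3-\widetilde N_1(\mu))$, $\Pi_{\overline{1_{\mathcal C}}}=\widetilde N_1(\mu)$, $\Pi_{0_{\mathcal C}}=\tfrac23(q-\widetilde N_1(\mu))$; $\Lambda_{2_{\mathcal C}}=q-1$, $\Lambda_{3_{\mathcal C}}=q-3-\widetilde N_1(\mu)$, $\Lambda_{\overline{1_{\mathcal C}}}=\widetilde N_1(\mu)$, $\Lambda_{0_{\mathcal C}}=q-\widetilde N_1(\mu)$.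
   Context: Let $\mathbb F_q$ be the field of order $q$ and $\mathrm{PG}(3,q)$ the projective space with points $\mathbf P(x_0,x_1,x_2,x_3)$. For $t\in\mathbb F_q$ put $P(t)=\mathbf P(t^3,t^2,t,1)$, and $P(\infty)=\mathbf P(1,0,0,0)$; the twisted cubic is $\mathcal C=\{P(t):t\in\mathbb F_q\cup\{\infty\}\}$ and $G_q$ is the group of projectivities fixing $\mathcal C$. The osculating plane at $P(t)$ is $t$-plane $x_0-3tx_1+3t^2x_2-t^3x_3=0$ ($t\in\mathbb F_q$) and $x_3=0$ at $P(\infty)$; these are the $\Gamma$-planes. The tangent at $P(t)$, $t\in\mathbb F_q$, is the line through $P(t)$ and $\mathbf P(3t^2,2t,1,0)$; at $P(\infty)$ it is the line through $\mathbf P(1,0,0,0),\mathbf P(0,1,0,0)$. Plane types: a $d_{\mathcal C}$-plane ($d\in\{0,2,3\}$) contains exactly $d$ points of $\mathcal C$; a $\overline{1_{\mathcal C}}$-plane is a non-$\Gamma$-plane containing exactly one point of $\mathcal C$ (orbit sizes $q^2+q$, $(q^3-q)/6$, $(q^3-q)/2$, $(q^3-q)/3$ for $2_{\mathcal C},3_{\mathcal C},\overline{1_{\mathcal C}},0_{\mathcal C}$). Point types: $\mathcal C$-points; $T$-points: points off $\mathcal C$ on a tangent; $\mu_\Gamma$-points ($\mu\in\{0,1,3\}$): points off $\mathcal C$ in exactly $\mu$ distinct $\Gamma$-planes (orbit sizes $q^2+q$, $(q^3-q)/6$, $(q^3-q)/2$, $(q^3-q)/3$ for $T,3_\Gamma,1_\Gamma,0_\Gamma$).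 For a $G_q$-orbit $\mathcal O$ of lines, $\Pi_\pi$ = number of $\pi$-planes through a line of $\mathcal O$, $\Lambda_\pi$ = number of lines of $\mathcal O$ in a $\pi$-plane, $P_{\mathfrak p}$ = number of $\mathfrak p$-points on a line of $\mathcal O$, $L_{\mathfrak p}$ = number of lines of $\mathcal O$ through a $\mathfrak p$-point (all independent of the choices). $\ell_\mu$ is the line through $\mathbf P(0,\mu,0,1)$ and $\mathbf P(1,0,1,0)$, i.e. $\{\mathbf P(\gamma,\mu,\gamma,1):\gamma\in\mathbb F_q\}\cup\{\mathbf P(1,0,1,0)\}$; for even $q$ it is known that $\#\mathcal O_\mu=(q^3-q)/2$. $N_1(\mu)$ is the number of $\gamma\in\mathbb F_q$ such that $t^3+\gamma t^2+\mu t+\gamma=0$ has exactly one solution $t\in\mathbb F_q$; $\widetilde N_1(\mu)$ is the number of $c\in\mathbb F_q^*$ such that $t^3+ct^2+t+\mu c=0$ has exactly one solution $t\in\mathbb F_q$. *)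

(* Defs.v *)
(* PG(3,q) is modelled via the row spaces of F^4 (mxalgebra):
   a point / line / plane is a canonical subspace <<X>>%MS of rank 1 / 2 / 3,
   stored as a 4x4 matrix.  Incidence is row-space inclusion (X <= Y)%MS. *)
From HB Require Import structures.
From mathcomp Require Import all_boot all_order all_algebra.
Set Implicit Arguments. Unset Strict Implicit. Unset Printing Implicit Defensive.
Import Order.TTheory GRing.Theory Num.Theory.
Local Open Scope ring_scope.

Section PG3.
Variable F : finFieldType.

Definition subsp (k : nat) (X : 'M[F]_4) : bool := (\rank X == k) && (<<X>>%MS == X).
Definition is_point := subsp 1.
Definition is_line := subsp 2.
Definition is_plane := subsp 3.

Definition vec4 (a b c d : F) : 'rV[F]_4 := \row_(i < 4) nth 0 [:: a; b; c; d] i.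
Definition pt (v : 'rV[F]_4) : 'M[F]_4 := <<v>>%MS.
Definition line2 (u v : 'rV[F]_4) : 'M[F]_4 := <<col_mx u v>>%MS.
Definition plane_eq (a : 'rV[F]_4) : 'M[F]_4 := <<kermx a^T>>%MS.

Definition Pt (t : F) : 'M[F]_4 := pt (vec4 (t ^+ 3) (t ^+ 2) t 1).
Definition Pinf : 'M[F]_4 := pt (vec4 1 0 0 0).
Definition onC (X : 'M[F]_4) : bool := [exists t : F, X == Pt t] || (X == Pinf).

(* osculating planes (Gamma-planes) *)
Definition gamma_plane (t : F) : 'M[F]_4 :=
  plane_eq (vec4 1 (- (3%:R * t)) (3%:R * t ^+ 2) (- t ^+ 3)).
Definition gamma_inf : 'M[F]_4 := plane_eq (vec4 0 0 0 1).
Definition is_Gamma_plane (Y : 'M[F]_4) : bool :=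
  [exists t : F, Y == gamma_plane t] || (Y == gamma_inf).

Definition tangent (t : F) : 'M[F]_4 :=
  line2 (vec4 (t ^+ 3) (t ^+ 2) t 1) (vec4 (3%:R * t ^+ 2) (2%:R * t) 1 0).
Definition tangent_inf : 'M[F]_4 := line2 (vec4 1 0 0 0) (vec4 0 1 0 0).
Definition on_tangent (X : 'M[F]_4) : bool :=
  [exists t : F, (X <= tangent t)%MS] || (X <= tangent_inf)%MS.

Definition C_point (X : 'M[F]_4) : bool := is_point X && onC X.
Definition T_point (X : 'M[F]_4) : bool := [&& is_point X, ~~ onC X & on_tangent X].
Definition nGamma (X : 'M[F]_4) : nat :=
  #|[set Y : 'M[F]_4 | is_Gamma_plane Y && (X <= Y)%MS]|.
Definition muGamma_point (mu : nat) (X : 'M[F]_4) : bool :=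
  [&& is_point X, ~~ onC X & nGamma X == mu].

Definition nC (Y : 'M[F]_4) : nat := #|[set X : 'M[F]_4 | onC X && (X <= Y)%MS]|.
Definition dC_plane (d : nat) (Y : 'M[F]_4) : bool := is_plane Y && (nC Y == d).
Definition onebar_plane (Y : 'M[F]_4) : bool :=
  [&& is_plane Y, ~~ is_Gamma_plane Y & nC Y == 1%N].

Definition proj_act (A X : 'M[F]_4) : 'M[F]_4 := <<X *m A>>%MS.
Definition Gq : {set 'M[F]_4} :=
  [set A : 'M[F]_4 | (A \in unitmx) &&
     [forall X : 'M[F]_4, is_point X ==> (onC (proj_act A X) == onC X)]].

Definition ell (mu : F) : 'M[F]_4 := line2 (vec4 0 mu 0 1) (vec4 1 0 1 0).
Definition orbitO (mu : F) : {set 'M[F]_4} :=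
  [set L : 'M[F]_4 | [exists A in Gq, L == proj_act A (ell mu)]].

Definition Pi_cnt (ptype : pred 'M[F]_4) (L : 'M[F]_4) : nat :=
  #|[set Y : 'M[F]_4 | ptype Y && (L <= Y)%MS]|.
Definition P_cnt (ptype : pred 'M[F]_4) (L : 'M[F]_4) : nat :=
  #|[set X : 'M[F]_4 | ptype X && (X <= L)%MS]|.
Definition Lambda_cnt (O : {set 'M[F]_4}) (Y : 'M[F]_4) : nat :=
  #|[set L in O | (L <= Y)%MS]|.
Definition L_cnt (O : {set 'M[F]_4}) (X : 'M[F]_4) : nat :=
  #|[set L in O | (X <= L)%MS]|.

Definition N1 (mu : F) : nat :=
  #|[set g : F | #|[set t : F | t ^+ 3 + g * t ^+ 2 + mu * t + g == 0]| == 1%N]|.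
Definition N1t (mu : F) : nat :=
  #|[set c : F | (c != 0) &&
     (#|[set t : F | t ^+ 3 + c * t ^+ 2 + t + mu * c == 0]| == 1%N)]|.

End PG3.

(* Main.v *)
(* In characteristic 2 the third symmetric power of the natural module of GL_2
   becomes a twisted tensor square: writing the point (x0, x1, x2, x3) as the
   2x2 matrix X = (x0 x1; x2 x3) and phi for the entrywise Frobenius, M in GL_2
   acts by X |-> phi(M)^T X M.  The osculating planes through X are the zeros in
   P^1 of the cubic form phi(v)^T X v, the C- and T-points are the X of rank 1,
   and a plane with coordinates X read backwards meets the twisted cubic in the
   zeros of the same form; so the plane counts are the point counts of the polar
   line, which lies in the orbit of ell_(1/mu).

   The points of each type form one orbit of GL_2, and the number of M sending X
   to a multiple of Y is (q-1) times 3, 2, q-1, 6 for forms with 0, 1, 2, 3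
   zeros.  With zeros, this is a computation on normal forms; without zeros,
   the stabiliser modulo scalars has at most 3 elements, and equality follows by
   counting invertible X.  As exactly 2(q-1) matrices fix ell_mu, counting the
   pairs (M, Y) with X M ~ Y on ell_mu gives the number of lines through X.
   That G_q consists of the maps above follows because quadrics through the
   twisted cubic give polynomials of degree at most 6 < q. *)
Require Import Defs.
From HB Require Import structures.
From mathcomp Require Import all_boot all_order all_algebra.
From mathcomp Require Import finfield ring zify.
Import Order.TTheory GRing.Theory Num.Theory.
Local Open Scope ring_scope.

Section Char2.
Set Implicit Arguments.
Unset Strict Implicit.
Unset Printing Implicit Defensive.
Variable F : finFieldType.
Hypothesis two0 : 2%:R = 0 :> F.

Implicit Types (X M : 'M[F]_2) (o : option F) (v : F * F).

Let even0 (n : nat) : (2 * n)%:R = 0 :> F.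
Proof. by rewrite natrM two0 mul0r. Qed.
Let four0 : 4%:R = 0 :> F. Proof. exact: (even0 2). Qed.
Let six0 : 6%:R = 0 :> F. Proof. exact: (even0 3). Qed.
Let eight0 : 8%:R = 0 :> F. Proof. exact: (even0 4). Qed.
Let ten0 : 10%:R = 0 :> F. Proof. exact: (even0 5). Qed.
Let ntwo0 : - 2%:R = 0 :> F. Proof. by rewrite two0 oppr0. Qed.
Let nfour0 : - 4%:R = 0 :> F. Proof. by rewrite four0 oppr0. Qed.
Let nsix0 : - 6%:R = 0 :> F. Proof. by rewrite six0 oppr0. Qed.

(* [ring] modulo 2: the difference of the two sides has even coefficients. *)
Local Ltac ring2 := apply/eqP; rewrite -subr_eq0; apply/eqP;
  ring: two0 four0 six0 eight0 ten0 ntwo0 nfour0 nsix0.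

(** * Cubic forms as 2x2 matrices *)

Lemma addxx2 (x : F) : x + x = 0.
Proof. ring2. Qed.

Lemma oppr2 (x : F) : - x = x.
Proof. ring2. Qed.

Lemma addr_eq02 (x y : F) : (x + y == 0) = (x == y).
Proof. by rewrite -(subr_eq0 x y) oppr2. Qed.

Lemma sqr_inj2 : injective (fun x : F => x ^+ 2).
Proof.
move=> x y /= e; apply/eqP; rewrite -addr_eq02 -sqrf_eq0; apply/eqP.
by transitivity (x ^+ 2 + y ^+ 2); [ring2 | rewrite e addxx2].
Qed.

Lemma sqr_surj2 (y : F) : exists x, x ^+ 2 = y.
Proof. by exists (invF sqr_inj2 y); rewrite (f_invF sqr_inj2). Qed.

Definition mk2 (a b c d : F) : 'M[F]_2 :=
  \matrix_(i, j) if i == 0 then (if j == 0 then a else b)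
                 else (if j == 0 then c else d).

Lemma mk2E a b c d : (mk2 a b c d 0 0 = a) * (mk2 a b c d 0 1 = b)
  * (mk2 a b c d 1 0 = c) * (mk2 a b c d 1 1 = d).
Proof. by rewrite !mxE. Qed.

Lemma ord2_cases (P : 'I_2 -> Prop) : P 0 -> P 1 -> forall i, P i.
Proof.
move=> P0 P1 [[|[|//]] h].
- by rewrite (_ : Ordinal h = 0) //; apply: val_inj.
- by rewrite (_ : Ordinal h = 1) //; apply: val_inj.
Qed.

Lemma mx2P (A B : 'M[F]_2) :
  A 0 0 = B 0 0 -> A 0 1 = B 0 1 -> A 1 0 = B 1 0 -> A 1 1 = B 1 1 -> A = B.
Proof.
move=> h00 h01 h10 h11; apply/matrixP.
by apply: ord2_cases; apply: ord2_cases.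
Qed.

Lemma mk2_inj a b c d a' b' c' d' :
  mk2 a b c d = mk2 a' b' c' d' -> [/\ a = a', b = b', c = c' & d = d'].
Proof.
move=> e; split.
- by rewrite -(mk2E a b c d).1.1.1 e mk2E.
- by rewrite -(mk2E a b c d).1.1.2 e mk2E.
- by rewrite -(mk2E a b c d).1.2 e mk2E.
- by rewrite -(mk2E a b c d).2 e mk2E.
Qed.

Lemma mulmx2E (A B : 'M[F]_2) i j : (A *m B) i j = A i 0 * B 0 j + A i 1 * B 1 j.
Proof.
rewrite !mxE !big_ord_recl big_ord0 addr0.
by congr (_ * _ + _ * _); congr fun_of_matrix; apply: val_inj.
Qed.

Lemma det2E (A : 'M[F]_2) : \det A = A 0 0 * A 1 1 + A 0 1 * A 1 0.
Proof.
rewrite (expand_det_row _ 0) !big_ord_recl big_ord0 addr0 /cofactor !det_mx11 !mxE /=.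
rewrite (_ : lift ord0 ord0 = 1) /=; last exact: val_inj.
rewrite (_ : lift 1 0 = 0) /=; last exact: val_inj.
rewrite /bump /=.
by rewrite /= expr0 expr1 mul1r mulN1r oppr2.
Qed.

Lemma unit2E (A : 'M[F]_2) : (A \in unitmx) = (\det A != 0).
Proof. by rewrite unitmxE unitfE. Qed.

Definition act (M X : 'M[F]_2) : 'M[F]_2 :=
  (map_mx (fun x => x ^+ 2) M)^T *m X *m M.

Lemma actE M X : act M X = let a := M 0 0 in let b := M 0 1 in
  let c := M 1 0 in let d := M 1 1 in
  let x := X 0 0 in let y := X 0 1 in let z := X 1 0 in let t := X 1 1 in
  mk2 (a^+2 * (x * a + y * c) + c^+2 * (z * a + t * c))
      (a^+2 * (x * b + y * d) + c^+2 * (z * b + t * d))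
      (b^+2 * (x * a + y * c) + d^+2 * (z * a + t * c))
      (b^+2 * (x * b + y * d) + d^+2 * (z * b + t * d)).
Proof. by apply: mx2P; rewrite /= !mk2E /act !(mulmx2E, mxE); ring2. Qed.

Lemma actM M N X : act M (act N X) = act (N *m M) X.
Proof. by rewrite !actE /=; apply: mx2P; rewrite !(mulmx2E, mk2E); ring2. Qed.

Lemma act1 X : act 1%:M X = X.
Proof. by rewrite actE /= !mxE /=; apply: mx2P; rewrite !mk2E; ring2. Qed.

Lemma actZ M c X : act M (c *: X) = c *: act M X.
Proof. by rewrite /act -scalemxAr -scalemxAl. Qed.

Lemma actD M X Y : act M (X + Y) = act M X + act M Y.
Proof. by rewrite /act mulmxDr mulmxDl. Qed.

(** Scalars act by their cubes, so scalar matrices fix every projective point; hence the factor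
    [#|F|.-1] in the counts of matrices below. *)
Lemma actZl c M X : act (c *: M) X = c ^+ 3 *: act M X.
Proof. by rewrite !actE /=; apply: mx2P; rewrite !(mxE, mk2E); rewrite /=; ring2. Qed.

Lemma det_act M X : \det (act M X) = \det M ^+ 3 * \det X.
Proof. by rewrite !det2E actE /= !mk2E; ring2. Qed.

Lemma actK M X : M \in unitmx -> act (invmx M) (act M X) = X.
Proof. by move=> uM; rewrite actM mulmxV // act1. Qed.

Lemma actVK M X : M \in unitmx -> act M (act (invmx M) X) = X.
Proof. by move=> uM; rewrite actM mulVmx // act1. Qed.

Lemma act_eq0 M X : M \in unitmx -> (act M X == 0) = (X == 0).
Proof.
move=> uM; apply/eqP/eqP => [e|->]; last by rewrite /act mulmx0 mul0mx.
by rewrite -(actK X uM) e /act mulmx0 mul0mx.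
Qed.

Definition sim (X Y : 'M[F]_2) := [exists c : F, (c != 0) && (Y == c *: X)].

Lemma simP X Y : reflect (exists2 c : F, c != 0 & Y = c *: X) (sim X Y).
Proof.
apply: (iffP existsP) => [[c /andP[c0 /eqP ->]]|[c c0 ->]]; first by exists c.
by exists c; rewrite c0 eqxx.
Qed.

Lemma sim_refl X : sim X X.
Proof. by apply/simP; exists 1; rewrite ?oner_neq0 ?scale1r. Qed.

Lemma simC X Y : sim X Y = sim Y X.
Proof.
suff h A B : sim A B -> sim B A by apply/idP/idP; apply: h.
by case/simP => c c0 ->; apply/simP; exists c^-1; rewrite ?invr_eq0 // scalerA mulVf // scale1r.
Qed.

Lemma sim_trans Y X Z : sim X Y -> sim Y Z -> sim X Z.
Proof.
case/simP => c c0 ->; case/simP => d d0 ->.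
by apply/simP; exists (d * c); rewrite ?mulf_neq0 // scalerA.
Qed.

Lemma sim_act M X Y : M \in unitmx -> sim (act M X) (act M Y) = sim X Y.
Proof.
move=> uM; apply/simP/simP => -[c c0 e]; exists c => //; last by rewrite e actZ.
by rewrite -(actK Y uM) e actZ actK.
Qed.

Lemma sim_eq0 X Y : sim X Y -> (X == 0) = (Y == 0).
Proof. by case/simP => c c0 ->; rewrite scaler_eq0 (negbTE c0). Qed.

(* The cubic form attached to [X]: its value at [(1, u)] is the value at the
   point [x] of the equation of the osculating plane of parameter [u]. *)
Definition form (X : 'M[F]_2) (v : F * F) : F :=
  v.1 ^+ 2 * (X 0 0 * v.1 + X 0 1 * v.2) + v.2 ^+ 2 * (X 1 0 * v.1 + X 1 1 * v.2).

Definition mulv (M : 'M[F]_2) (v : F * F) : F * F :=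
  (M 0 0 * v.1 + M 0 1 * v.2, M 1 0 * v.1 + M 1 1 * v.2).

Definition sclv (c : F) (v : F * F) : F * F := (c * v.1, c * v.2).

Lemma mulvM M N v : mulv (M *m N) v = mulv M (mulv N v).
Proof. by rewrite /mulv /= !mulmx2E; congr (_, _); ring2. Qed.

Lemma mulv1 v : mulv 1%:M v = v.
Proof. by rewrite /mulv !mxE /= !(mul1r, mul0r, addr0, add0r); case: v. Qed.

Lemma mulvZ M c v : mulv M (sclv c v) = sclv c (mulv M v).
Proof. by rewrite /mulv /sclv /=; congr (_, _); ring. Qed.

Lemma form_act M X v : form (act M X) v = form X (mulv M v).
Proof. by rewrite /form actE /= !mk2E; ring2. Qed.

Lemma formZ X c v : form X (sclv c v) = c ^+ 3 * form X v.
Proof. by rewrite /form /=; ring. Qed.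

Lemma formZl X c v : form (c *: X) v = c * form X v.
Proof. by rewrite /form !mxE /=; ring. Qed.

(** The projective line, with [None] for (0 : 1). Here the first coordinate is normalised, whereas
    [cpt] is built from (t, 1); [swp] reconciles the two. *)
Definition pv (o : option F) : F * F := if o is Some u then (1, u) else (0, 1).
Definition idx (v : F * F) : option F :=
  if v.1 == 0 then None else Some (v.2 / v.1).
Definition pscale (v : F * F) : F := if v.1 == 0 then v.2 else v.1.

(** Valid for the zero vector too: there [idx] is [None] and [pscale] is 0. *)
Lemma idxE v : v = sclv (pscale v) (pv (idx v)).
Proof.
case: v => p r; rewrite /pscale /idx /sclv /=; case: eqP => [->|/eqP h] /=.
  by rewrite mulr0 mulr1.
by rewrite mulr1 mulrC divfK.
Qed.

Lemma pscale_neq0 v : v != 0 -> pscale v != 0.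
Proof.
case: v => p r; rewrite /pscale /= -[0]/(0, 0) xpair_eqE negb_and.
by case: eqP => /= // /eqP ->.
Qed.

Lemma idxZ c v : c != 0 -> idx (sclv c v) = idx v.
Proof.
move=> c0; rewrite /idx /= mulf_eq0 (negbTE c0) /=; case: eqP => // _.
by rewrite -mulf_div divff // mul1r.
Qed.

Lemma pvK : cancel pv idx.
Proof. by case=> [u|]; rewrite /idx /= ?eqxx // oner_eq0 divr1. Qed.

Lemma pv_neq0 o : pv o != 0.
Proof. by case: o => [u|]; rewrite -[0]/(0, 0) xpair_eqE ?oner_eq0 ?andbF. Qed.

Lemma mulv_neq0 M v : M \in unitmx -> v != 0 -> mulv M v != 0.
Proof.
move=> uM; apply: contraNneq => e.
by rewrite -(mulv1 v) -(mulVmx uM) mulvM e /mulv /= !mulr0 !addr0.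
Qed.

Definition mact (M : 'M[F]_2) (o : option F) := idx (mulv M (pv o)).

Lemma mact_pv M o : M \in unitmx ->
  exists2 c : F, c != 0 & mulv M (pv o) = sclv c (pv (mact M o)).
Proof.
move=> uM; exists (pscale (mulv M (pv o))); last exact: idxE.
by apply: pscale_neq0; apply: mulv_neq0 => //; apply: pv_neq0.
Qed.

Lemma mactM M N o : M \in unitmx -> N \in unitmx ->
  mact (M *m N) o = mact M (mact N o).
Proof.
move=> uM uN; rewrite [LHS]/mact mulvM; have [c c0 ->] := mact_pv o uN.
by rewrite mulvZ idxZ //.
Qed.

Lemma mact1 o : mact 1%:M o = o.
Proof. by rewrite /mact mulv1 pvK. Qed.

Lemma mactK M : M \in unitmx -> cancel (mact M) (mact (invmx M)).
Proof. by move=> uM o; rewrite -mactM ?unitmx_inv // mulVmx // mact1. Qed.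

Lemma mactVK M : M \in unitmx -> cancel (mact (invmx M)) (mact M).
Proof. by move=> uM o; rewrite -mactM ?unitmx_inv // mulmxV // mact1. Qed.

Definition root X o := form X (pv o) == 0.

Lemma root_act M X o : M \in unitmx -> root (act M X) o = root X (mact M o).
Proof.
move=> uM; rewrite /root form_act; have [c c0 ->] := mact_pv o uM.
by rewrite formZ mulf_eq0 expf_eq0 (negbTE c0).
Qed.

Lemma root_sim X Y o : sim X Y -> root Y o = root X o.
Proof. by case/simP => c c0 ->; rewrite /root formZl mulf_eq0 (negbTE c0). Qed.

Definition nroots X := #|[set o | root X o]|.

Lemma nroots_act M X : M \in unitmx -> nroots (act M X) = nroots X.
Proof.
move=> uM; rewrite /nroots -[RHS](on_card_preimset (f := mact M)); last first.
  by apply: onW_bij; exists (mact (invmx M)); [exact: mactK | exact: mactVK].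
by apply: eq_card => o; rewrite !inE root_act.
Qed.

Lemma nroots_sim X Y : sim X Y -> nroots Y = nroots X.
Proof. by move=> s; apply: eq_card => o; rewrite !inE (root_sim _ s). Qed.

(* The point of the twisted cubic as [phi(a) a^T] with [a = (t, 1)] or [(1, 0)]. *)
Definition cpt (o : option F) : 'M[F]_2 :=
  if o is Some t then mk2 (t ^+ 3) (t ^+ 2) t 1 else mk2 1 0 0 0.

(** The outer product of the Frobenius image of [u] with [v]; a matrix [M] acts on it through [M^T]
    on both factors. *)
Definition rk1 (u v : F * F) : 'M[F]_2 :=
  mk2 (u.1 ^+ 2 * v.1) (u.1 ^+ 2 * v.2) (u.2 ^+ 2 * v.1) (u.2 ^+ 2 * v.2).

Definition isC X := [exists o, sim (cpt o) X].

Lemma act_rk1 M u v : act M (rk1 u v) = rk1 (mulv M^T u) (mulv M^T v).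
Proof. by rewrite actE /= !mk2E /rk1 /= !mxE; apply: mx2P; rewrite !mk2E; ring2. Qed.

Definition swp (v : F * F) := (v.2, v.1).

Lemma cptE o : cpt o = rk1 (swp (pv o)) (swp (pv o)).
Proof. by case: o => [t|]; rewrite /rk1 /=; apply: mx2P; rewrite !mk2E; ring. Qed.

Lemma rk1Z c d u v : rk1 (sclv c u) (sclv d v) = (c ^+ 2 * d) *: rk1 u v.
Proof. by rewrite /rk1 /=; apply: mx2P; rewrite !(mxE, mk2E) /=; ring. Qed.

Lemma isCP X : X != 0 -> reflect (exists v c, X = c *: rk1 v v) (isC X).
Proof.
move=> X0; apply: (iffP existsP) => [[o /simP[c c0 ->]]|[v [c e]]].
  by exists (swp (pv o)), c; rewrite cptE.
have c0 : c != 0 by apply: contraNneq X0 => c0; rewrite e c0 scale0r.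
have v0 : swp v != 0.
  apply: contraNneq X0 => v0; rewrite e /rk1.
  case: v v0 {e} => p r [-> ->] /=; rewrite (_ : mk2 _ _ _ _ = 0) ?scaler0 //.
  by apply: mx2P; rewrite mk2E mxE /= mulr0.
exists (idx (swp v)); rewrite cptE; apply/simP.
exists (c * pscale (swp v) ^+ 3); first by rewrite mulf_neq0 ?expf_neq0 ?pscale_neq0.
rewrite e -scalerA exprSr -rk1Z; congr (_ *: _).
have vE : v = sclv (pscale (swp v)) (swp (pv (idx (swp v)))).
  transitivity (swp (swp v)); first by case: (v).
  by rewrite {1}(idxE (swp v)).
by congr (rk1 _ _).
Qed.

Lemma isC_act M X : M \in unitmx -> isC (act M X) = isC X.
Proof.
move=> uM; have [->|X0] := eqVneq X 0.
  by rewrite (eqP (_ : act M 0 == 0)) // act_eq0.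
suff h N Y : Y != 0 -> N \in unitmx -> isC Y -> isC (act N Y).
  apply/idP/idP => [|/h]; last exact.
  by rewrite -{2}(actK X uM); apply: h; rewrite ?act_eq0 ?unitmx_inv.
move=> Y0 uN /(isCP Y0)[v [c e]]; apply/isCP; first by rewrite act_eq0.
by exists (mulv N^T v), c; rewrite e actZ act_rk1.
Qed.

Lemma isC_sim X Y : sim X Y -> isC Y = isC X.
Proof.
suff h A B : sim A B -> isC A -> isC B.
  by move=> s; apply/idP/idP; apply: h; rewrite // simC.
by move=> s /existsP[o so]; apply/existsP; exists o; apply: sim_trans s.
Qed.

(** Covers the [k]-Gamma points for [k] = 0, 1, 3 and, by [ctype2E], the T-points for [k] = 2.
    Points of the cubic also have one zero, so they are excluded explicitly. *)
Definition ctype (k : nat) (X : 'M[F]_2) := [&& X != 0, ~~ isC X & nroots X == k].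

Lemma ctype_act k M X : M \in unitmx -> ctype k (act M X) = ctype k X.
Proof. by move=> uM; rewrite /ctype act_eq0 ?isC_act ?nroots_act. Qed.

Lemma ctype_sim k X Y : sim X Y -> ctype k Y = ctype k X.
Proof. by move=> s; rewrite /ctype (sim_eq0 s) (isC_sim s) (nroots_sim s). Qed.


(** * Transporters between points *)

Lemma det_cpt o : \det (cpt o) = 0.
Proof. by case: o => [t|]; rewrite det2E !mk2E; ring2. Qed.

Lemma detZ2 c (X : 'M[F]_2) : \det (c *: X) = c ^+ 2 * \det X.
Proof. by rewrite !det2E !mxE; ring. Qed.

Lemma isC_det X : isC X -> \det X = 0.
Proof. by case/existsP => o /simP[c c0 ->]; rewrite detZ2 det_cpt mulr0. Qed.

Lemma root_cpt o o' : root (cpt o) o' = (o' == o).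
Proof.
rewrite /root; case: o o' => [t|] [u|]; rewrite /form /= !mk2E /=.
- rewrite (_ : _ + _ = (u + t) ^+ 3); last by ring2.
  by rewrite expf_eq0 /= addr_eq02.
- by rewrite (_ : _ + _ = 1) ?oner_eq0 //; ring.
- by rewrite (_ : _ + _ = 1) ?oner_eq0 //; ring.
- by rewrite (_ : _ + _ = 0) ?eqxx //; ring.
Qed.

Lemma isC_nroots X : isC X -> nroots X = 1%N.
Proof.
case/existsP => o so; rewrite (nroots_sim so) /nroots -(cards1 o).
by apply: eq_card => o'; rewrite !inE root_cpt.
Qed.

(** The rows are proportional, and the twist on the left factor is undone by a square root of their
    ratio. *)
Lemma rk1P X : \det X = 0 -> exists u v, X = rk1 u v.
Proof.
rewrite det2E => /eqP; rewrite addr_eq02 => /eqP d0.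
have [x00|x0] := eqVneq (X 0 0) 0; last first.
  have [s es] := sqr_surj2 (X 1 0 / X 0 0).
  exists (1, s), (X 0 0, X 0 1); rewrite /rk1 /= es.
  apply: mx2P; rewrite mk2E; [ring | ring | by rewrite divfK |].
  by rewrite mulrAC [X 1 0 * _]mulrC -d0 mulrAC divff // mul1r.
have [x10|x1] := eqVneq (X 0 1) 0.
  by exists (0, 1), (X 1 0, X 1 1); apply: mx2P; rewrite mk2E /= ?x00 ?x10; ring.
have [s es] := sqr_surj2 (X 1 1 / X 0 1).
exists (1, s), (X 0 0, X 0 1); rewrite /rk1 /= es.
apply: mx2P; rewrite mk2E; [ring | ring | | by rewrite divfK].
by move/eqP: d0; rewrite x00 mul0r mulr0 eq_sym mulf_eq0 (negbTE x1) => /eqP.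
Qed.

Definition nfT := mk2 0 1 0 0.

(** Write [X] as [rk1 u v] and let [A] have rows [u] and [v]. If [A] were singular, [u] and [v]
    would be proportional and [X] would lie on the cubic. *)
Lemma nfTP X : X != 0 -> \det X = 0 -> ~~ isC X ->
  exists2 A, A \in unitmx & X = act A nfT.
Proof.
move=> X0 d0 nC; have [[u1 u2] [[v1 v2] e]] := rk1P d0.
have nfTE : nfT = rk1 (1, 0) (0, 1) by apply: mx2P; rewrite !mk2E /=; ring.
exists (mk2 u1 u2 v1 v2); last first.
  by rewrite nfTE act_rk1 e; congr (rk1 (_, _) (_, _)); rewrite !mxE /=; ring.
rewrite unit2E det2E !mk2E; apply: contra nC => /eqP D0.
apply/(isCP X0); have [u0|u0] := eqVneq (u1, u2) 0.
  by case: u0 X0 e => -> -> X0 e; exists (0, 0), 1; rewrite scale1r e;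
     apply: mx2P; rewrite !mk2E /=; ring.
have hv : u1 * v2 = u2 * v1.
  by apply/eqP; rewrite -addr_eq02 D0.
exists (u1, u2); have [u10|u10] := eqVneq u1 0.
  have u20 : u2 != 0 by apply: contraNneq u0 => ->; rewrite u10.
  have v10 : v1 = 0.
    by move/eqP: hv; rewrite u10 mul0r eq_sym mulf_eq0 (negbTE u20) => /eqP.
  exists (v2 / u2); rewrite e u10 v10; apply: mx2P; rewrite !(mxE, mk2E) /=; try ring.
  by field.
exists (v1 / u1); rewrite e.
have -> : v2 = u2 * v1 / u1 by rewrite -hv; field.
by apply: mx2P; rewrite !(mxE, mk2E) /=; field.
Qed.

Lemma nroots_nfT : nroots nfT = 2%N.
Proof.
rewrite /nroots; have <- : #|[set Some 0; None : option F]| = 2%N by rewrite cards2.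
apply: eq_card => -[u|]; rewrite !inE /root /form /= !mk2E.
  by rewrite (_ : _ + _ = u); [rewrite orbF | ring].
by rewrite (_ : _ + _ = 0) ?eqxx //; ring.
Qed.

(** * Artin-Schreier equations and normal forms of nonsingular points with a zero *)

Definition AS (c : F) := [set b : F | b ^+ 2 + b == c].

Lemma card_AS b c : b \in AS c -> #|AS c| = 2%N.
Proof.
rewrite inE => /eqP <-; transitivity #|[set b; b + 1]|; last first.
  by rewrite cards2 -addr_eq02 addrA addxx2 add0r oner_eq0.
apply: eq_card => x; rewrite !inE -addr_eq02.
rewrite (_ : _ + (b ^+ 2 + b) = (x + b) * (x + (b + 1))); last by ring2.
by rewrite mulf_eq0 !addr_eq02.
Qed.

Lemma card_AS_cases c : {#|AS c| = 0%N} + {#|AS c| = 2%N}.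
Proof.
by case: (set_0Vmem (AS c)) => [->|[b /card_AS]]; [left; rewrite cards0 | right].
Qed.

Definition ASim := [set b ^+ 2 + b | b : F].

Lemma mem_ASim c : (c \in ASim) = (#|AS c| == 2%N).
Proof.
apply/imsetP/eqP => [[b _ ->]|]; first by apply: (@card_AS b); rewrite inE.
case: (set_0Vmem (AS c)) => [->|[b]]; first by rewrite cards0.
by rewrite inE => /eqP <- _; exists b.
Qed.

(** The additive map [b ^+ 2 + b] is two-to-one, its kernel being {0, 1}. *)
Lemma card_ASim : (2 * #|ASim|)%N = #|F|.
Proof.
rewrite mulnC -sum_nat_const -(sum1_card F).
rewrite [RHS](partition_big_imset (fun b : F => b ^+ 2 + b)) /=.
apply: eq_bigr => c; rewrite mem_ASim => /eqP cA; rewrite -[LHS]cA -sum1_card.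
by apply: eq_bigl => b; rewrite inE.
Qed.

(** [ASim] is an additive subgroup of index 2: when [c] lies outside, the coset of [c] misses [ASim]
    and by cardinality is its whole complement. *)
Lemma ASimD c c' : (c \in ASim) = (c' \in ASim) -> c + c' \in ASim.
Proof.
case cI: (c \in ASim) => /esym c'I.
  case/imsetP: cI => b _ ->; case/imsetP: c'I => b' _ ->.
  by apply/imsetP; exists (b + b') => //; ring2.
have inj : injective (+%R c) by exact: addrI.
have sub : [set c + x | x in ASim] \subset ~: ASim.
  apply/subsetP => _ /imsetP[_ /imsetP[b _ ->] ->]; rewrite inE.
  apply: contraFN cI => /imsetP[b' _ e]; apply/imsetP; exists (b + b') => //.
  by apply: (addIr (b ^+ 2 + b)); rewrite e; ring2.
have /eqP eqs : [set c + x | x in ASim] == ~: ASim.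
  rewrite eqEcard sub card_imset //= cardsCs setCK -card_ASim.
  by rewrite mul2n -addnn addnK.
have : c' \in ~: ASim by rewrite inE c'I.
rewrite -eqs => /imsetP[x xI ->].
by rewrite addrA addxx2 add0r.
Qed.

Lemma ASimN : exists c, c \notin ASim.
Proof.
have q0 : (0 < #|F|)%N by apply/card_gt0P; exists 0.
have : (0 < #|~: ASim|)%N.
  rewrite cardsCs setCK -card_ASim mul2n -addnn addnK.
  by move: q0; rewrite -card_ASim muln_gt0.
by case/card_gt0P => c; rewrite inE => h; exists c.
Qed.

(** The form takes the value [c + u + u ^+ 2] at (1, u) and vanishes at (0, 1), so its zeros are
    [None] and the Artin-Schreier solutions for [c]. *)
Definition nf (c : F) := mk2 c 1 1 0.

Lemma det_nf c : \det (nf c) = 1.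
Proof. by rewrite det2E !mk2E; ring. Qed.

Lemma nroots_nf c : nroots (nf c) = (1 + #|AS c|)%N.
Proof.
rewrite /nroots (_ : [set o | _] = None |: Some @: AS c).
  rewrite cardsU1 card_imset; last exact: Some_inj.
  by case: imsetP => // -[].
apply/setP => -[u|]; rewrite !inE /root /form /= !mk2E.
  rewrite (mem_imset _ _ (@Some_inj _)) inE -[RHS]addr_eq02; congr (_ == _); ring.
by rewrite (_ : _ + _ = 0) ?eqxx //; ring.
Qed.

(** First [P] moves the given zero to [None], which kills the last entry; then a diagonal matrix
    makes the two off-diagonal entries equal. *)
Lemma nfP X o : \det X != 0 -> root X o ->
  exists A c, [/\ A \in unitmx, sim (act A X) (nf c) & mact A None = o].
Proof.
move=> dX rX; pose P := if o is Some u then mk2 0 1 1 u else 1%:M.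
have uP : P \in unitmx.
  rewrite /P; case: (o) => [u|]; rewrite ?unitmx1 // unit2E det2E !mk2E.
  by rewrite mul0r mul1r add0r oner_eq0.
have PN : mact P None = o.
  rewrite /P; case: (o) => [u|]; rewrite ?mact1 // /mact /mulv !mk2E /idx /=.
  by rewrite !mulr0 !mulr1 !add0r oner_eq0 divr1.
have [Y YE] : exists Y, act P X = Y by exists (act P X).
move: rX; rewrite -PN -root_act // YE => rY.
have dY : \det Y != 0 by rewrite -YE det_act mulf_neq0 ?expf_neq0 // -unit2E.
have y3 : Y 1 1 = 0.
  by move: rY; rewrite /root /form /= => /eqP <-; ring.
move: dY; rewrite det2E y3 mulr0 add0r mulf_eq0 negb_or => /andP[y1 y2].
(* With these diagonal entries both off-diagonal entries of [act D Y] become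
   [Y 0 1 ^+ 2 * Y 1 0 ^+ 2], the scalar that [sim] removes. *)
pose D := mk2 (Y 1 0) 0 0 (Y 0 1).
have uD : D \in unitmx.
  by rewrite unit2E det2E !mk2E mulr0 addr0 mulf_neq0.
exists (P *m D), (Y 1 0 * Y 0 0 / Y 0 1 ^+ 2); split.
- by rewrite unitmx_mul uP.
- rewrite -actM YE simC; apply/simP; exists (Y 0 1 ^+ 2 * Y 1 0 ^+ 2).
    by rewrite mulf_neq0 ?expf_neq0.
  rewrite actE /= !mk2E y3; apply: mx2P; rewrite !(mxE, mk2E) /=; try ring.
  by field.
- rewrite mactM // (_ : mact D None = None) //.
  by rewrite /mact /D /mulv !mk2E /idx /= mulr0 mul0r add0r eqxx.
Qed.

Lemma det_nroots X : \det X != 0 -> (0 < nroots X)%N ->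
  nroots X = 1%N \/ nroots X = 3%N.
Proof.
move=> dX /card_gt0P[o]; rewrite inE => rX.
have [A [c [uA s _]]] := nfP dX rX.
rewrite -(nroots_act X uA) -(nroots_sim s) nroots_nf.
by case: (card_AS_cases c) => ->; [left | right].
Qed.

(** A singular point off the cubic is equivalent to [nfT], which has two zeros, while a nonsingular
    point has 0, 1 or 3 zeros. *)
Lemma ctype2E X : ctype 2 X = [&& X != 0, ~~ isC X & \det X == 0].
Proof.
rewrite /ctype; have [//|X0] := eqVneq X 0; case nC: (isC X) => //=.
apply/eqP/eqP => [n2|d0]; last first.
  have [A uA ->] := nfTP X0 d0 (negbT nC).
  by rewrite nroots_act // nroots_nfT.
apply/eqP/idPn => dX; have := det_nroots dX; rewrite n2.
by case=> [|//|//].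
Qed.

Lemma ctype_det k X : k != 2%N -> ctype k X = (\det X != 0) && (nroots X == k).
Proof.
move=> k2; have [dX|dX] /= := eqVneq (\det X) 0; last first.
  rewrite /ctype (contraNneq _ dX) ?(contraNN _ dX) //; first by move/isC_det/eqP.
  by move=> ->; rewrite det0.
apply/negP => /and3P[X0 nC /eqP nk].
have : ctype 2 X by rewrite ctype2E X0 nC dX eqxx.
by case/and3P => _ _; rewrite nk (negbTE k2).
Qed.

Lemma card_nz : #|[set c : F | c != 0]| = #|F|.-1.
Proof. by rewrite -(cardsC1 (0 : F)); apply: eq_card => c; rewrite !inE. Qed.

(** Matrices are counted, not projectivities. The variant [transp_at] also prescribes that the zero
    [o'] of [Y] be carried to the zero [o] of [X]. *)
Definition transp X Y := #|[set M : 'M[F]_2 | (M \in unitmx) && sim (act M X) Y]|.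
Definition transp_at X o Y o' := #|[set M : 'M[F]_2 |
  [&& M \in unitmx, sim (act M X) Y & mact M o' == o]]|.

Lemma conj_bij (A B : 'M[F]_2) : A \in unitmx -> B \in unitmx ->
  bijective (fun M => A *m M *m B).
Proof.
move=> uA uB; exists (fun M => invmx A *m M *m invmx B) => M.
  by rewrite -!mulmxA mulmxV // mulmx1 mulKmx.
by rewrite -!mulmxA mulVmx // mulmx1 mulKVmx.
Qed.

Lemma transp_act A B X Y : A \in unitmx -> B \in unitmx ->
  transp (act A X) (act B Y) = transp X Y.
Proof.
move=> uA uB; have uB' : invmx B \in unitmx by rewrite unitmx_inv.
rewrite /transp -[RHS](on_card_preimset (onW_bij _ (conj_bij uA uB'))).
apply: eq_card => M; rewrite !inE !unitmx_mul uA uB' andbT /=.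
by rewrite -!actM -[Y in RHS](actK _ uB) sim_act.
Qed.

Lemma transp_at_act A B X o Y o' : A \in unitmx -> B \in unitmx ->
  transp_at (act A X) o (act B Y) o' = transp_at X (mact A o) Y (mact B o').
Proof.
move=> uA uB; have uB' : invmx B \in unitmx by rewrite unitmx_inv.
rewrite /transp_at -[RHS](on_card_preimset (onW_bij _ (conj_bij uA uB'))).
apply: eq_card => M; rewrite !inE !unitmx_mul uA uB' andbT /=.
case uM: (M \in unitmx) => //=.
rewrite -!actM -[Y in RHS](actK _ uB) sim_act //.
rewrite !mactM ?unitmx_mul ?uA //= mactK //.
by rewrite (can_eq (mactK uA)).
Qed.

Lemma sim_congr X X' Y Y' : sim X X' -> sim Y Y' -> sim X' Y' = sim X Y.
Proof.
move=> sX sY; apply/idP/idP => h.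
  by apply: (sim_trans sX); apply: (sim_trans h); rewrite simC.
by rewrite simC in sX; apply: (sim_trans sX); apply: (sim_trans h).
Qed.

Lemma transp_sim X X' Y Y' : sim X X' -> sim Y Y' -> transp X' Y' = transp X Y.
Proof.
move=> sX sY; apply: eq_card => M; rewrite !inE; case uM: (M \in unitmx) => //=.
by apply: sim_congr; rewrite ?sim_act.
Qed.

Lemma transp_at_sim X X' Y Y' o o' : sim X X' -> sim Y Y' -> transp_at X' o Y' o' = transp_at X o Y o'.
Proof.
move=> sX sY; apply: eq_card => M; rewrite !inE; case uM: (M \in unitmx) => //=.
by congr (_ && _); apply: sim_congr; rewrite ?sim_act.
Qed.

(** The form of [nfT] has a double zero and a simple one, and both must be fixed; the matrices are
    therefore the invertible diagonal ones. *)
Lemma transp_nfT : transp nfT nfT = (#|F|.-1 * #|F|.-1)%N.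
Proof.
rewrite /transp -card_nz -cardsX.
rewrite -(card_imset (f := fun p : F * F => mk2 p.1 0 0 p.2)); last first.
  by move=> [a d] [a' d'] /mk2_inj[/= -> _ _ ->].
apply: eq_card => M; rewrite inE; apply/andP/imsetP.
  case=> uM /simP[k k0]; rewrite actE /= !mk2E => e.
  have := congr1 (fun Z : 'M[F]_2 => Z 0 1) e; rewrite !(mxE, mk2E) /=.
  have := congr1 (fun Z : 'M[F]_2 => Z 0 0) e; rewrite !(mxE, mk2E) /=.
  have := congr1 (fun Z : 'M[F]_2 => Z 1 1) e; rewrite !(mxE, mk2E) /=.
  rewrite !(mul0r, mul1r, add0r, mulr0, addr0).
  move=> e11 e00 e01.
  have: k * (M 0 0 ^+ 2 * M 1 1) != 0 by rewrite -e01 oner_eq0.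
  rewrite mulf_eq0 mulf_eq0 expf_eq0 !negb_or => /and3P[_ /= a0 d0].
  exists (M 0 0, M 1 1); first by rewrite !inE a0.
  apply: mx2P; rewrite mk2E //=; apply/eqP.
    by move/eqP: e11; rewrite eq_sym mulf_eq0 mulf_eq0 sqrf_eq0 (negbTE k0) (negbTE d0) orbF.
  by move/eqP: e00; rewrite eq_sym mulf_eq0 mulf_eq0 sqrf_eq0 (negbTE k0) (negbTE a0).
case=> -[a d]; rewrite !inE => /andP[/= a0 d0] ->; split.
  by rewrite unit2E det2E !mk2E mulr0 addr0 mulf_neq0.
rewrite simC; apply/simP; exists (a ^+ 2 * d); first by rewrite mulf_neq0 ?expf_neq0.
by rewrite actE /= !mk2E; apply: mx2P; rewrite !(mxE, mk2E) /=; ring.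
Qed.

(** Fixing [None] makes [M] lower triangular, and the off-diagonal entries force equal diagonal
    entries [a]. With [M 1 0 = a * b] the remaining condition is [b ^+ 2 + b = c + c']. *)
Lemma transp_at_nf c c' :
  transp_at (nf c) None (nf c') None = (#|F|.-1 * #|AS (c + c')%R|)%N.
Proof.
rewrite /transp_at -card_nz -cardsX.
rewrite -(card_in_imset (f := fun p : F * F => mk2 p.1 0 (p.1 * p.2) p.1)); last first.
  move=> [a b] [a' b']; rewrite !inE => /andP[/= a0 _] _ /mk2_inj[/= <- _ e _].
  by congr (_, _); apply: (mulfI a0).
apply: eq_card => M; rewrite inE; apply/and3P/imsetP.
  case=> uM /simP[k k0 e].
  rewrite /mact /idx /= !mulr0 !mulr1 !add0r; have [b0 _|//] := eqVneq (M 0 1) 0.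
  move: uM; rewrite unit2E det2E b0 mul0r addr0 mulf_eq0 negb_or => /andP[a0 d0].
  move: e; rewrite actE /= !mk2E b0 => e.
  have := congr1 (fun Z : 'M[F]_2 => Z 0 0) e; rewrite !(mxE, mk2E) /=.
  have := congr1 (fun Z : 'M[F]_2 => Z 0 1) e; rewrite !(mxE, mk2E) /=.
  have := congr1 (fun Z : 'M[F]_2 => Z 1 0) e; rewrite !(mxE, mk2E) /=.
  rewrite !(mul0r, mul1r, add0r, mulr0, mulr1, addr0, expr0n) /=.
  move=> e10 e01 e00.
  have ad : M 1 1 = M 0 0.
    apply: (mulfI k0); apply: (mulfI d0); apply: (mulfI a0).
    transitivity (k * (M 1 1 ^+ 2 * M 0 0)); first by ring.
    by rewrite -e10 e01; ring.
  have kE : k = (M 0 0 ^+ 3)^-1.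
    apply: (mulIf (_ : M 0 0 ^+ 3 != 0)); first by rewrite expf_neq0.
    by rewrite mulVf ?expf_neq0 // [RHS]e01 ad; ring.
  exists (M 0 0, M 1 0 / M 0 0).
    rewrite !inE a0 /= e00 kE; apply/eqP.
    transitivity (c + c + ((M 1 0 / M 0 0) ^+ 2 + M 1 0 / M 0 0)).
      by rewrite addxx2 add0r.
    by field.
  by apply: mx2P; rewrite mk2E //= mulrC divfK.
case=> -[a b]; rewrite !inE => /andP[/= a0 /eqP bE] ->; split.
- by rewrite unit2E det2E !mk2E mul0r addr0 mulf_neq0.
- rewrite simC; apply/simP; exists (a ^+ 3); first by rewrite expf_neq0.
  rewrite actE /= !mk2E; apply: mx2P; rewrite !(mxE, mk2E) /=; try ring.
  have -> : c' = b ^+ 2 + b + c by rewrite bE; ring2.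
  by ring.
- by rewrite /mact /mulv !mk2E /idx /= mulr0 mul0r addr0 eqxx.
Qed.

(** A matrix taking [X] to [Y] carries the zeros of [Y] to those of [X]; split according to the zero
    of [Y] that lands on [o]. *)
Lemma transp_sum_root X Y o : root X o ->
  transp X Y = (\sum_(o' | root Y o') transp_at X o Y o')%N.
Proof.
move=> rX; rewrite /transp -sum1_card.
rewrite (partition_big (fun M => mact (invmx M) o) (root Y)) /=; last first.
  move=> M; rewrite inE => /andP[uM s].
  by rewrite (root_sim _ s) root_act // mactVK.
apply: eq_bigr => o' _; rewrite /transp_at -sum1_card; apply: eq_bigl => M.
rewrite !inE -andbA; case uM: (M \in unitmx) => //=; congr (_ && _).
by apply/eqP/eqP => <-; rewrite ?mactVK ?mactK.
Qed.

(** Once a zero of [Y] is matched with one of [X], both reduce to [nf c] and [nf c']. Equal numbers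
    of zeros put [c] and [c'] on the same side of the index 2 subgroup, so [AS (c + c')] has two
    elements. *)
Lemma transp_det X Y : \det X != 0 -> \det Y != 0 -> nroots X = nroots Y ->
  (0 < nroots X)%N -> transp X Y = (nroots Y * (#|F|.-1 * 2))%N.
Proof.
move=> dX dY eXY nX; have /card_gt0P[o] := nX; rewrite inE => rX.
rewrite (transp_sum_root Y rX) (eq_bigr (fun=> (#|F|.-1 * 2)%N)) => [|o' rY].
  rewrite sum_nat_const; congr (_ * _)%N; apply: eq_card => o'.
  by rewrite inE.
have [A [c [uA sA <-]]] := nfP dX rX.
have [B [c' [uB sB <-]]] := nfP dY rY.
rewrite -transp_at_act // -(transp_at_sim _ _ sA sB) transp_at_nf; congr (_ * _)%N.
apply/eqP; rewrite -mem_ASim; apply: ASimD; rewrite !mem_ASim.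
have := nroots_nf c; rewrite (nroots_sim sA) nroots_act // eXY.
have := nroots_nf c'; rewrite (nroots_sim sB) nroots_act // => ->.
by move/eqP; rewrite eqn_add2l => /eqP ->.
Qed.

(** * Stabilisers of points whose form has no zero *)

Definition adj2 (M : 'M[F]_2) := mk2 (M 1 1) (M 0 1) (M 1 0) (M 0 0).

Lemma adj2E M : M *m adj2 M = (\det M)%:M.
Proof. by apply: mx2P; rewrite mulmx2E !mk2E !mxE det2E /=; ring2. Qed.

Lemma adj2C M : adj2 M *m M = (\det M)%:M.
Proof. by apply: mx2P; rewrite mulmx2E !mk2E !mxE det2E /=; ring2. Qed.

Lemma adj2D M N : adj2 (M + N) = adj2 M + adj2 N.
Proof. by apply: mx2P; rewrite !(mxE, mk2E). Qed.

(** For determinant 1, the fixing condition says that the transposed Frobenius image of [M] times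
    [X] equals [X *m adj2 M]. This is additive in [M]; multiplying back by [M + N] gives the
    determinant. *)
Lemma act_add_det1 X M N : \det M = 1 -> \det N = 1 ->
  act M X = X -> act N X = X -> act (M + N) X = \det (M + N) *: X.
Proof.
have h P : \det P = 1 -> act P X = X ->
    (map_mx (fun x => x ^+ 2) P)^T *m X = X *m adj2 P.
  by move=> dP e; rewrite -[in RHS]e /act -!mulmxA adj2E dP mulmx1.
move=> dM dN eM eN; rewrite -mul_mx_scalar -adj2C adj2D mulmxA [X *m _]mulmxDr -(h M) // -(h N) //.
rewrite /act -mulmxDl; congr (_ *m _ *m _).
by apply: mx2P; rewrite !mxE; ring2.
Qed.

(* For distinct [M], [N] in the stabiliser, [M + N] is again in it, because
   [act M X = X] is additive in [M] when [\det M = 1]; as the polar form of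
   [\det] is then [1] on distinct elements, three elements sum to zero. *)
Lemma card_stab_irr X : \det X != 0 -> nroots X = 0%N ->
  (#|[set M : 'M[F]_2 | (\det M == 1%R) && (act M X == X)]| <= 3)%N.
Proof.
move=> dX nX; set S := [set M | _].
have SD M N : M \in S -> N \in S -> M != N -> M + N \in S.
  rewrite !inE => /andP[/eqP dM /eqP eM] /andP[/eqP dN /eqP eN] MN.
  have e := act_add_det1 dM dN eM eN; set P := M + N in e *.
  have dP : \det P != 0.
    (* A singular [P] sends [X] to 0, so the form vanishes on the image of [P]; having no zeros, it
       leaves only the zero image. *)
    apply/eqP => dP; have P0 : P != 0.
      apply: contra MN => /eqP P0; rewrite -[M](addrK N) -/P P0 sub0r.
      by apply/eqP/matrixP => i j; rewrite mxE oppr2.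
    have hw v : mulv P v == 0.
      apply: contraT => v0; suff : (0 < nroots X)%N by rewrite nX.
      apply/card_gt0P; exists (idx (mulv P v)); rewrite inE /root.
      have : form X (mulv P v) == 0.
        by rewrite -form_act e dP formZl mul0r.
      by rewrite {1}(idxE (mulv P v)) formZ mulf_eq0 expf_eq0 (negbTE (pscale_neq0 v0)).
    move: P0; apply/negP; rewrite negbK; apply/eqP.
    have /eqP[a c] := hw (1, 0); have /eqP[b d] := hw (0, 1).
    move: a b c d; rewrite !(mulr0, mulr1, addr0, add0r) => a b c d.
    by apply: mx2P; rewrite [RHS]mxE.
  have : \det P ^+ 3 * \det X = \det P ^+ 2 * \det X.
    by rewrite -det_act e detZ2.
  move/(mulIf dX); rewrite exprS -[RHS]mul1r => /(mulIf (expf_neq0 _ dP)) d1.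
  by rewrite d1 eqxx e d1 scale1r eqxx.
have dD (M N : 'M[F]_2) : \det (M + N) = \det M + \det N + (M 0 0 * N 1 1 + M 1 1 * N 0 0
    + M 0 1 * N 1 0 + M 1 0 * N 0 1).
  by rewrite !det2E !mxE; ring.
have pol M N : M \in S -> N \in S -> M != N ->
    M 0 0 * N 1 1 + M 1 1 * N 0 0 + M 0 1 * N 1 0 + M 1 0 * N 0 1 = 1.
  move=> MS NS MN; have := SD _ _ MS NS MN; move: MS NS; rewrite !inE.
  case/andP=> /eqP dM _ /andP[/eqP dN _] /andP[/eqP].
  by rewrite dD dM dN addxx2 add0r.
rewrite leqNgt; apply/negP => c4.
have [M [N [MS NS MN]]] : exists M N, [/\ M \in S, N \in S & M != N].
  by apply/card_gt1P; apply: leq_trans c4.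
have /subset_leq_card : S \subset [set M; N; M + N].
  apply/subsetP => P PS; rewrite !inE; apply/idPn; rewrite !negb_or => /andP[/andP[PM PN] PMN].
  have := pol _ _ PS (SD _ _ MS NS MN) PMN; have := pol _ _ PS MS PM.
  have := pol _ _ PS NS PN; rewrite !mxE => e1 e2 e3.
  have /eqP : (1 : F) = 0; last by rewrite oner_eq0.
  rewrite -{1}e3 -(addxx2 1) -{1}e1 -e2; ring.
rewrite leqNgt (leq_trans _ c4) // ltnS.
by rewrite (leq_trans (leq_card_setU _ _)) // cards1 addn1 ltnS cards2; case: eqP.
Qed.

Lemma transp_irr_self X : \det X != 0 -> nroots X = 0%N -> (transp X X <= 3 * #|F|.-1)%N.
Proof.
move=> dX nX; apply: leq_trans (leq_mul (card_stab_irr dX nX) (leqnn _)).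
rewrite -card_nz -cardsX.
pose f (p : 'M[F]_2 * F) := p.2 *: p.1.
apply: leq_trans (leq_imset_card f _); apply: subset_leq_card.
apply/subsetP => M; rewrite inE => /andP[uM /simP[k k0 e]].
have dM : \det M != 0 by rewrite -unit2E.
have d : k ^+ 2 * \det M ^+ 3 = 1.
  apply: (mulIf dX); have := congr1 determinant e.
  by rewrite detZ2 det_act mul1r mulrA => <-.
(* Comparing determinants, [k ^+ 2 * \det M ^+ 3 = 1], so [s^-1 *: M] has
   determinant 1 and fixes [X]. *)
pose s := (k * \det M)^-1.
have s0 : s != 0 by rewrite invr_eq0 mulf_neq0.
have ds : \det M = s ^+ 2.
  have n0 : k * \det M != 0 by rewrite mulf_neq0.
  apply: (mulIf (expf_neq0 2 n0)); rewrite /s exprVn mulVf ?expf_neq0 //.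
  by rewrite -[RHS]d; ring.
have ks : k * s ^+ 3 = 1.
  have -> : s ^+ 3 = s * s ^+ 2 by rewrite exprS.
  by rewrite -ds mulrCA mulVf // mulf_neq0.
apply/imsetP; exists (s^-1 *: M, s); last by rewrite /f /= scalerA divff // scale1r.
rewrite !inE s0 andbT /= detZ2 ds actZl; apply/andP; split.
  by apply/eqP; field.
apply/eqP; rewrite [in RHS]e; congr (_ *: _).
by apply: (mulIf (expf_neq0 3 s0)); rewrite ks; field.
Qed.

(** * Nonsingular points counted by their number of zeros *)

Definition nonsing (k : nat) := [set X : 'M[F]_2 | (\det X != 0) && (nroots X == k)].

Definition GL := [set M : 'M[F]_2 | M \in unitmx].

(** Count pairs (M, Y): for each invertible [M] the admissible [Y] are the nonzero multiples of
    [act M X]. *)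
Lemma sum_transp k X : X \in nonsing k -> (\sum_(Y in nonsing k) transp X Y = #|GL| * #|F|.-1)%N.
Proof.
rewrite inE => /andP[dX /eqP nX].
have X0 : X != 0 by apply: contraNneq dX => ->; rewrite det0.
under eq_bigr => Y _ do rewrite /transp -sum1dep_card.
rewrite (exchange_big_dep (fun M => M \in unitmx)) /=; last by move=> Y M _ /andP[].
rewrite (eq_bigr (fun=> #|F|.-1)) => [|M uM].
  by rewrite sum_nat_const; congr (_ * _)%N; apply: eq_card => M; rewrite inE.
have dM : \det M != 0 by rewrite -unit2E.
have aX0 : act M X != 0 by rewrite act_eq0.
rewrite sum1dep_card -card_nz -[RHS](card_imset (f := fun c => c *: act M X)).
  apply: eq_card => Y; rewrite !inE uM /=; apply/idP/imsetP.
    by case/andP=> _ /simP[c c0 ->]; exists c; rewrite ?inE.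
  case=> c; rewrite inE => c0 ->; rewrite detZ2 det_act !mulf_neq0 ?expf_neq0 //=.
  have s : sim (act M X) (c *: act M X) by apply/simP; exists c.
  by rewrite s (nroots_sim s) nroots_act // nX eqxx.
move=> c d /eqP; rewrite -subr_eq0 -scalerBl scaler_eq0 (negbTE aX0) orbF subr_eq0.
by move/eqP.
Qed.

Lemma q1_gt0 : (0 < #|F|.-1)%N.
Proof. by rewrite -card_nz; apply/card_gt0P; exists 1; rewrite inE oner_eq0. Qed.

Lemma card_nonsing k X : X \in nonsing k -> (0 < k)%N -> (#|nonsing k| * (k * 2) = #|GL|)%N.
Proof.
move=> XV k0; apply/eqP; rewrite -(eqn_pmul2r q1_gt0) -(sum_transp XV).
rewrite (eq_bigr (fun=> (k * (#|F|.-1 * 2))%N)).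
  by rewrite sum_nat_const -!mulnA [(2 * _)%N]mulnC.
move: XV; rewrite inE => /andP[dX /eqP nX] Y; rewrite inE => /andP[dY /eqP nY].
by rewrite (transp_det dX dY) ?nX ?nY.
Qed.

(** Nonsingular points and invertible matrices are the same 2x2 matrices. Types 1 and 3 take up one
    half and one sixth of them, which leaves one third for type 0. *)
Lemma card_nonsing0 : (#|nonsing 0| * 3 = #|GL|)%N.
Proof.
have [c cN] := ASimN.
have c0 : #|AS c| = 0%N.
  by case: (card_AS_cases c) => // e; move: cN; rewrite mem_ASim e.
have h1 : nf c \in nonsing 1 by rewrite inE det_nf oner_eq0 nroots_nf c0.
have h3 : nf 0 \in nonsing 3.
  by rewrite inE det_nf oner_eq0 nroots_nf (@card_AS 0) // inE expr0n /= addr0.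
have e1 := card_nonsing h1 isT; have e3 := card_nonsing h3 isT.
have : (#|nonsing 0| + #|nonsing 1| + #|nonsing 3| = #|GL|)%N.
  have -> : GL = nonsing 0 :|: nonsing 1 :|: nonsing 3.
    apply/setP => X; rewrite !inE unit2E; case: eqVneq => //= dX.
    case: (posnP (nroots X)) => [->//|/(det_nroots dX)].
    by case=> ->.
  have dis a b : a != b -> [disjoint nonsing a & nonsing b].
    move=> ab; apply/pred0P => X /=; rewrite !inE; case: (_ != 0) => //=.
    by case: eqP => //= ->; rewrite (negbTE ab).
  rewrite !cardsU !disjoint_setI0 ?cards0 ?subn0 ?dis //.
  apply/pred0P => X /=; rewrite !inE.
  by case: (_ != 0) => //=; case: (nroots X) => [|[|n]].
lia.
Qed.

(** Each term of [sum_transp] is at most [3 * #|F|.-1], and by [card_nonsing0] the sum equals this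
    bound times the number of terms; so every term attains it. *)
Lemma transp_irr X Y : \det X != 0 -> \det Y != 0 -> nroots X = 0%N -> nroots Y = 0%N ->
  transp X Y = (3 * #|F|.-1)%N.
Proof.
move=> dX dY nX nY.
have XV : X \in nonsing 0 by rewrite inE dX nX.
have YV : Y \in nonsing 0 by rewrite inE dY nY.
have le Z : Z \in nonsing 0 -> (transp X Z <= 3 * #|F|.-1)%N.
  rewrite inE => /andP[dZ /eqP nZ].
  have [->//|/card_gt0P[M]] := posnP (transp X Z).
  rewrite inE => /andP[uM s].
  by rewrite (transp_sim (sim_refl _) s) -(act1 X) transp_act ?unitmx1 ?act1 ?transp_irr_self.
have := sum_transp XV; rewrite -card_nonsing0 -mulnA -sum_nat_const.
rewrite (bigD1 Y) //= [RHS](bigD1 Y) //=.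
have [lt /eqP|lt|//] := ltngtP (transp X Y) (3 * #|F|.-1); last first.
  by move: lt; rewrite ltnNge le.
rewrite ltn_eqF // -addSn leq_add // leq_sum // => Z /andP[ZV _].
exact: le.
Qed.

(* Order, modulo scalars, of the stabiliser of a point whose form has [k] zeros. *)
Definition stab_size (k : nat) : nat :=
  match k with 0 => 3 | 1 => 2 | 2 => #|F|.-1 | _ => 6 end.

Lemma nroots_cases X : \det X != 0 -> nroots X \in [:: 0; 1; 3]%N.
Proof.
move=> dX; case: (posnP (nroots X)) => [->//|/(det_nroots dX)].
by case=> ->.
Qed.

Lemma transp_ctype k X Y : ctype k X -> ctype k Y -> transp X Y = (stab_size k * #|F|.-1)%N.
Proof.
have [->|k2] := eqVneq k 2%N.
  rewrite !ctype2E => /and3P[X0 XC /eqP dX] /and3P[Y0 YC /eqP dY].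
  have [A uA ->] := nfTP X0 dX XC; have [B uB ->] := nfTP Y0 dY YC.
  by rewrite transp_act // transp_nfT.
rewrite !ctype_det // => /andP[dX /eqP nX] /andP[dY /eqP nY].
have := nroots_cases dX; rewrite nX !inE => /or3P[] /eqP k0.
- by rewrite transp_irr ?nX ?nY ?k0.
- by rewrite transp_det ?nX ?nY ?k0 //= mul1n mulnC.
- by rewrite transp_det ?nX ?nY ?k0 //= [(#|F|.-1 * 2)%N]mulnC mulnA.
Qed.

Lemma transp_ctype_neq k X Y : ctype k X -> ~~ ctype k Y -> transp X Y = 0%N.
Proof.
move=> cX; apply: contraNeq; rewrite -lt0n => /card_gt0P[M]; rewrite inE.
by case/andP=> uM s; rewrite (ctype_sim _ s) ctype_act.
Qed.

(** * The line ell_mu *)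

Definition lpt (mu : F) (o : option F) : 'M[F]_2 :=
  if o is Some g then mk2 g mu g 1 else mk2 1 0 1 0.

Definition inell mu (X : 'M[F]_2) := (X 0 0 == X 1 0) && (X 0 1 == mu * X 1 1).

(* Index of the point of [ell mu] represented by [X], meaningful only when
   [inell mu X]. *)
Definition pell (X : 'M[F]_2) : option F :=
  if X 1 1 == 0 then None else Some (X 0 0 / X 1 1).

Lemma lpt_neq0 mu o : lpt mu o != 0.
Proof.
case: o => [g|]; apply/eqP => e.
  have := mk2E g mu g 1; rewrite -/(lpt mu (Some g)) e !mxE => -[_ /eqP].
  by rewrite eq_sym oner_eq0.
have := mk2E 1 0 1 0; rewrite -/(lpt mu None) e !mxE => -[[[/eqP]]].
by rewrite eq_sym oner_eq0.
Qed.

Lemma sim_lpt mu X o : X != 0 -> sim X (lpt mu o) = inell mu X && (pell X == o).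
Proof.
move=> X0; rewrite simC; apply/simP/andP => [[c c0 ->]|[/andP[/eqP e0 /eqP e1] /eqP <-]].
  rewrite /inell /pell !mxE.
  case: o => [g|]; rewrite !mk2E /=.
    rewrite mulr1 (negbTE c0) eqxx mulrC eqxx; split=> //.
    by rewrite mulrAC divff // mul1r.
  by rewrite !mulr0 mulr1 !eqxx.
rewrite /pell; have [x3|x3] := eqVneq (X 1 1) 0.
  exists (X 0 0); last first.
    by apply: mx2P; rewrite !mxE /= ?e1 ?x3 ?e0 ?(mulr0, mulr1).
  apply: contraNneq X0 => x0; apply/eqP.
  by apply: mx2P; rewrite [RHS]mxE // -?e0 // e1 x3 mulr0.
by exists (X 1 1) => //; apply: mx2P; rewrite !mxE /= ?e1 ?e0; field.
Qed.

Lemma sim_lpt_inj mu o o' : sim (lpt mu o) (lpt mu o') -> o = o'.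
Proof.
have := sim_refl (lpt mu o); rewrite !sim_lpt ?lpt_neq0 //.
by case/andP=> _ /eqP -> /andP[_ /eqP].
Qed.

Lemma inellP mu X : X != 0 -> reflect (exists o, sim X (lpt mu o)) (inell mu X).
Proof.
move=> X0; apply: (iffP idP) => [h|[o]]; last by rewrite sim_lpt // => /andP[].
by exists (pell X); rewrite sim_lpt // h eqxx.
Qed.

Definition ntype (k : nat) (mu : F) := #|[set o | ctype k (lpt mu o)]|.

(** Split by the point of the line that [X] is sent to; only points of the same type are reached,
    each by the same number of matrices. *)
Lemma card_meet_ell mu k X : ctype k X ->
  #|[set M | (M \in unitmx) && inell mu (act M X)]|
    = (stab_size k * #|F|.-1 * ntype k mu)%N.
Proof.
move=> cX; have X0 : X != 0 by case/and3P: cX.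
rewrite -sum1_card (partition_big (fun M => pell (act M X)) predT) //=.
rewrite (eq_bigr (fun o => transp X (lpt mu o))) => [|o _]; last first.
  rewrite /transp -sum1_card; apply: eq_bigl => M; rewrite !inE -andbA.
  by case uM: (M \in unitmx) => //=; rewrite sim_lpt ?act_eq0.
rewrite (bigID (fun o => ctype k (lpt mu o))) /= [X in (_ + X)%N]big1 ?addn0.
  rewrite (eq_bigr (fun=> (stab_size k * #|F|.-1)%N)) => [|o co]; last exact: transp_ctype.
  by rewrite sum_nat_const mulnC; congr (_ * _)%N; apply: eq_card => o; rewrite inE.
by move=> o; apply: transp_ctype_neq.
Qed.

Lemma lpt_ell mu X : inell mu X -> X = X 0 0 *: lpt mu None + X 1 1 *: lpt mu (Some 0).
Proof.
by case/andP=> /eqP e0 /eqP e1; apply: mx2P; rewrite !mxE /= ?e1 ?e0 ?(mulr0, mulr1, addr0, add0r) // mulrC.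
Qed.

Section Pencil.
Variable mu : F.
Hypotheses (mu0 : mu != 0) (mu1 : mu != 1).

(** Up to scalars this leaves the identity and one projectivity, which swaps the two T-points
    [lpt mu None] and [lpt mu (Some 0)]. The condition [mu != 1] allows cancelling [mu + 1]. *)
Lemma stab_ell_cases M : M \in unitmx ->
  inell mu (act M (lpt mu None)) -> inell mu (act M (lpt mu (Some 0))) ->
  [/\ M 0 0 = M 1 1, M 0 1 = 0 & M 1 0 = 0] \/
  [/\ M 0 0 = 0, M 1 1 = 0 & M 1 0 ^+ 2 = mu * M 0 1 ^+ 2].
Proof.
rewrite unit2E det2E /inell !actE /= !mk2E.
set a := M 0 0; set b := M 0 1; set c := M 1 0; set d := M 1 1.
rewrite !(mul0r, mulr0, mul1r, addr0, add0r) => dM /andP[/eqP e1 /eqP e2] /andP[/eqP e3 /eqP e4].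
have mu11 : mu + 1 != 0 by rewrite addr_eq02.
have [a0|a0] := eqVneq a 0.
  right; move: dM e1 e2 e3 e4; rewrite a0 mul0r add0r mulf_eq0 negb_or => /andP[b0 c0].
  rewrite !expr0n /= !(mul0r, add0r) => _ e2 e3 _; have c2 : c ^+ 2 = mu * b ^+ 2 + d ^+ 2.
    by apply: (mulIf c0); rewrite e3; ring.
  have d0 : d = 0.
    apply/eqP; rewrite -sqrf_eq0; apply/eqP; apply: (mulfI mu11).
    rewrite mulr0; apply: (mulfI b0); rewrite mulr0.
    have : mu * (b ^+ 2 * b + d ^+ 2 * b) + c ^+ 2 * b = 0.
      by rewrite -e2; ring2.
    by rewrite c2 => <-; ring2.
  by rewrite c2 d0 expr0n addr0.
left; have ac : a + c = b + d.
  apply: sqr_inj2; apply: (mulIf a0); transitivity (a ^+ 2 * a + c ^+ 2 * a).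
    by ring2.
  by rewrite e1; ring2.
(* Otherwise [e2] and [ac] leave [(mu + 1) * ((b + d) ^+ 2 * b) = 0], whence [b = d], [a = c] and
   [M] is singular. *)
have b0 : b = 0.
  apply/eqP; apply: contraNT dM => b0.
  have : (mu + 1) * ((b + d) ^+ 2 * b) == 0.
    apply/eqP; transitivity (mu * (b ^+ 2 * b + d ^+ 2 * b) + (a + c) ^+ 2 * b).
      by rewrite ac; ring2.
    transitivity (a ^+ 2 * b + c ^+ 2 * b + (a + c) ^+ 2 * b); first by rewrite e2.
    by ring2.
  rewrite mulf_eq0 (negbTE mu11) mulf_eq0 (negbTE b0) orbF sqrf_eq0 addr_eq02.
  move=> /eqP bd; move: ac; rewrite bd addxx2 => /eqP; rewrite addr_eq02 => /eqP ->.
  by rewrite mulrC addxx2.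
move: dM; rewrite b0 mul0r addr0 mulf_eq0 negb_or => /andP[_ d0].
have ad : a + c = d by rewrite ac b0 add0r.
have c0 : c = 0.
  apply/eqP; rewrite -sqrf_eq0; apply/eqP; apply: (mulfI mu11); rewrite mulr0.
  apply: (mulIf d0); rewrite mul0r.
  have d2 : d ^+ 2 = a ^+ 2 + c ^+ 2 by rewrite -ad; ring2.
  have : a ^+ 2 * (mu * d) + c ^+ 2 * d + mu * ((a ^+ 2 + c ^+ 2) * d) = 0.
    by rewrite -d2 e4 b0; ring2.
  by move=> <-; ring2.
by rewrite -ad c0 addr0.
Qed.

Lemma card_stab_ell :
  #|[set M | [&& M \in unitmx, inell mu (act M (lpt mu None))
               & inell mu (act M (lpt mu (Some 0)))]]| = (2 * #|F|.-1)%N.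
Proof.
have [m mE] := sqr_surj2 mu.
have m0 : m != 0 by apply: contraNneq mu0 => m0; rewrite -mE m0 expr0n.
(* The tag [true] gives the scalar matrices, [false] the antidiagonal ones, where [m] is the square
   root of [mu]. *)
pose f (p : bool * F) := if p.1 then mk2 p.2 0 0 p.2 else mk2 0 p.2 (m * p.2) 0.
transitivity #|setX [set: bool] [set c : F | c != 0]|; last first.
  by rewrite cardsX cardsT card_bool card_nz.
rewrite -(card_in_imset (f := f)); last first.
  move=> [[] a] [[] b]; rewrite !inE /= => a0 b0 /mk2_inj[] //=.
  - by move=> ->.
  - by move=> e; move: a0; rewrite e eqxx.
  - by move=> /esym e; move: b0; rewrite e eqxx.
  - by move=> _ ->.
apply: eq_card => M; rewrite inE; apply/and3P/imsetP.
  case=> uM h1 h2; case: (stab_ell_cases uM h1 h2) => [[e00 e01 e10]|[e00 e11 e10]].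
    exists (true, M 0 0); last by apply: mx2P; rewrite mk2E.
    rewrite !inE /=; apply: contraTneq uM => a0.
    by rewrite unit2E det2E a0 e01 !mul0r addr0 eqxx.
  exists (false, M 0 1).
    rewrite !inE /=; apply: contraTneq uM => a0.
    by rewrite unit2E det2E a0 e00 !mul0r addr0 eqxx.
  apply: mx2P; rewrite mk2E //; apply: sqr_inj2.
  by rewrite /= e10 exprMn mE.
case=> -[[] a]; rewrite !inE /= => a0 ->; rewrite unit2E det2E /inell !actE /= !mk2E.
  rewrite mulr0 addr0 mulf_neq0 //; split=> //; apply/andP; split; apply/eqP; ring.
rewrite -mE; split; first by rewrite mul0r add0r !mulf_neq0.
  by apply/andP; split; apply/eqP; ring.
by apply/andP; split; apply/eqP; ring.
Qed.

(** * Types of the points on the line *)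

Lemma nroots_lpt_None : nroots (lpt mu None) = 2%N.
Proof.
transitivity #|[set Some 1; None : option F]|; last by rewrite cards2.
apply: eq_card => -[u|]; rewrite !inE /root /form /= !mk2E.
  rewrite orbF (_ : _ + _ = (u + 1) ^+ 2); last by ring2.
  by rewrite sqrf_eq0 addr_eq02.
by rewrite (_ : _ + _ = 0) ?eqxx //; ring.
Qed.

Lemma nroots_lpt_Some g :
  nroots (lpt mu (Some g)) = #|[set t | t ^+ 3 + g * t ^+ 2 + mu * t + g == 0]|.
Proof.
rewrite -(card_imset _ (@Some_inj _)); apply: eq_card => -[u|]; rewrite !inE.
  rewrite (mem_imset _ _ (@Some_inj _)) inE /root /form /= !mk2E.
  by congr (_ == _); ring.
rewrite /root /form /= !mk2E (_ : _ + _ = 1); last by ring.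
by rewrite oner_eq0; apply/esym/imsetP => -[].
Qed.

Lemma nroots_lpt_0 : nroots (lpt mu (Some 0)) = 2%N.
Proof.
have [m mE] := sqr_surj2 mu.
have m0 : m != 0 by apply: contraNneq mu0 => m0; rewrite -mE m0 expr0n.
rewrite nroots_lpt_Some; transitivity #|[set 0; m]|.
  apply: eq_card => t; rewrite !inE (_ : _ + _ = t * (t + m) ^+ 2); last first.
    by rewrite -mE; ring2.
  by rewrite mulf_eq0 sqrf_eq0 addr_eq02.
by rewrite cards2 eq_sym m0.
Qed.

Lemma det_lpt g : g != 0 -> \det (lpt mu (Some g)) != 0.
Proof.
move=> g0; rewrite det2E !mk2E (_ : _ + _ = g * (mu + 1)); last by ring.
by rewrite mulf_neq0 // addr_eq02.
Qed.

(** A point of the cubic is singular with one zero, but the only singular points of the line are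
    [None] and [Some 0], which have two. *)
Lemma isC_lpt o : isC (lpt mu o) = false.
Proof.
apply/negbTE/negP => h; have := isC_nroots h; have := isC_det h.
case: o {h} => [g|]; last by rewrite nroots_lpt_None.
have [->|/det_lpt g0 /eqP] := eqVneq g 0; first by rewrite nroots_lpt_0.
by rewrite (negbTE g0).
Qed.

Lemma ctype_lpt k o : ctype k (lpt mu o) = (nroots (lpt mu o) == k).
Proof. by rewrite /ctype lpt_neq0 isC_lpt. Qed.

Lemma nroots_lpt2 o : (nroots (lpt mu o) == 2%N) = (o \in [set None; Some 0]).
Proof.
rewrite !inE; case: o => [g|]; last by rewrite nroots_lpt_None.
have [->|g0] := eqVneq g 0; first by rewrite nroots_lpt_0 !eqxx.
rewrite -[RHS]/(g == 0) (negbTE g0).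
have := nroots_cases (det_lpt g0); rewrite !inE.
by case/or3P=> /eqP ->.
Qed.

Lemma ntype2 : ntype 2 mu = 2%N.
Proof.
transitivity #|[set None; Some (0 : F)]|; last by rewrite cards2.
by apply: eq_card => o; rewrite -nroots_lpt2 !inE ctype_lpt.
Qed.

Lemma ntype1 : ntype 1 mu = N1 mu.
Proof.
rewrite /N1 -(card_imset _ (@Some_inj _)); apply: eq_card => -[g|].
  by rewrite (mem_imset _ _ (@Some_inj _)) !inE ctype_lpt nroots_lpt_Some.
rewrite inE ctype_lpt nroots_lpt_None; apply/esym/imsetP => -[] //.
Qed.

Lemma nroots_lpt_lt4 o : (nroots (lpt mu o) < 4)%N.
Proof.
have [|] := boolP (o \in [set None; Some 0]).
  by rewrite -nroots_lpt2 => /eqP ->.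
rewrite !inE; case: o => [g|] //= g0.
by have := nroots_cases (det_lpt g0); rewrite !inE => /or3P[] /eqP ->.
Qed.

Lemma ntype_sum k : ntype k mu = (\sum_o (nroots (lpt mu o) == k))%N.
Proof.
rewrite /ntype -sum1dep_card big_mkcond; apply: eq_bigr => o _.
by rewrite ctype_lpt; case: eqP.
Qed.

Lemma ntype_total : (ntype 0 mu + ntype 1 mu + ntype 2 mu + ntype 3 mu = #|F|.+1)%N.
Proof.
rewrite -card_option -sum1_card !ntype_sum -!big_split; apply: eq_bigr => o _ /=.
by have := nroots_lpt_lt4 o; case: (nroots _) => [|[|[|[|n]]]].
Qed.

(** Count pairs of a point of the line and an osculating plane through it: each of the [#|F|.+1]
    osculating planes meets the line in exactly one point. *)
Lemma ntype_roots : (ntype 1 mu + 2 * ntype 2 mu + 3 * ntype 3 mu = #|F|.+1)%N.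
Proof.
rewrite !ntype_sum !big_distrr /= -!big_split /=.
transitivity (\sum_o nroots (lpt mu o))%N.
  apply: eq_bigr => o _.
  by have := nroots_lpt_lt4 o; case: (nroots _) => [|[|[|[|n]]]].
under eq_bigr => o _ do rewrite /nroots -sum1dep_card.
rewrite (exchange_big_dep predT) //= -card_option -sum1_card.
apply: eq_bigr => -[t|] _; rewrite sum1dep_card; last first.
  apply/eqP/cards1P; exists None; apply/setP => -[g|]; rewrite !inE.
    by rewrite /root /form /= !mk2E (_ : _ + _ = 1) ?oner_eq0 //; ring.
  by rewrite /root /form /= !mk2E (_ : _ + _ = 0) ?eqxx //; ring.
have rN : root (lpt mu None) (Some t) = (t == 1).
  rewrite /root /form /= !mk2E (_ : _ + _ = (t + 1) ^+ 2); last by ring2.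
  by rewrite sqrf_eq0 addr_eq02.
have rS g : root (lpt mu (Some g)) (Some t) = (t ^+ 3 + mu * t == g * (t + 1) ^+ 2).
  rewrite /root /form /= !mk2E -[RHS]addr_eq02; congr (_ == _); ring2.
(* At [t = 1] the parameter [g] drops out of the equation, which then reads [1 + mu = 0], so only
   the point [None] remains; otherwise one solves for [g]. *)
apply/eqP/cards1P; have [t1|t1] := eqVneq t 1.
  exists None; apply/setP => -[g|]; rewrite !inE ?rN ?rS t1 ?eqxx //.
  rewrite addxx2 expr0n /= mulr0 expr1n mulr1 addrC addr_eq02.
  by rewrite (negbTE mu1).
have t11 : (t + 1) ^+ 2 != 0 by rewrite sqrf_eq0 addr_eq02.
exists (Some ((t ^+ 3 + mu * t) / (t + 1) ^+ 2)); apply/setP => -[g|].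
  rewrite !inE rS; apply/eqP/eqP => [->|[->]]; first by rewrite mulfK.
  by rewrite divfK.
by rewrite !inE rN (negbTE t1).
Qed.

(* [bil] is the polar form of [\det]; [bil X Z = 0] says that the point [Z]
   lies in the plane whose coordinates are those of [X] reversed. *)
Definition bil (X Z : 'M[F]_2) :=
  X 0 0 * Z 1 1 + X 0 1 * Z 1 0 + X 1 0 * Z 0 1 + X 1 1 * Z 0 0.

Lemma bil_act M X Z : bil (act M X) (act M Z) = \det M ^+ 3 * bil X Z.
Proof. by rewrite /bil det2E !actE /= !mk2E; ring2. Qed.

(** The two conditions define the polar line of [ell mu], given by [X 0 1 = X 1 1] and
    [X 0 0 = mu * X 1 0]. The diagonal matrix with entries 1 and the square root of [mu] carries it
    to the line of parameter [mu^-1]. *)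
Lemma dual_ell : exists2 D, D \in unitmx & forall X, inell mu^-1 (act D X) =
  (bil X (lpt mu None) == 0) && (bil X (lpt mu (Some 0)) == 0).
Proof.
have [m mE] := sqr_surj2 mu.
have m0 : m != 0 by apply: contraNneq mu0 => m0; rewrite -mE m0 expr0n.
exists (mk2 1 0 0 m); first by rewrite unit2E det2E !mk2E mulr0 addr0 mul1r.
move=> X; rewrite /bil /inell actE /= !mk2E -mE andbC; congr (_ && _).
  rewrite (_ : m ^- 2 * _ = m * X 1 1); last by field.
  rewrite (_ : 1 ^+ 2 * _ + _ = m * X 0 1); last by ring.
  by rewrite (inj_eq (mulfI m0)) -addr_eq02; congr (_ == _); ring.
by rewrite -addr_eq02; congr (_ == _); ring.
Qed.

(** Substitute [t] by [t / m] and put [g = c / m], where [m ^+ 2 = mu]. The excluded value [c = 0]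
    would not count anyway: its cubic has two solutions. *)
Lemma N1t_N1 : N1t mu = N1 mu^-1.
Proof.
have [m mE] := sqr_surj2 mu.
have m0 : m != 0 by apply: contraNneq mu0 => m0; rewrite -mE m0 expr0n.
have cS c : #|[set t : F | t ^+ 3 + c / m * t ^+ 2 + mu^-1 * t + c / m == 0]| =
            #|[set t : F | t ^+ 3 + c * t ^+ 2 + t + mu * c == 0]|.
  rewrite -[RHS](on_card_preimset (f := *%R m)); last first.
    by apply: onW_bij; exists ( *%R m^-1); [exact: mulKf | exact: mulVKf].
  apply: eq_card => t; rewrite !inE -(inj_eq (mulfI (expf_neq0 3 m0))) mulr0.
  by congr (_ == _); rewrite -mE; field.
rewrite /N1t /N1 -[RHS](on_card_preimset (f := fun c => c / m)); last first.
  by apply: onW_bij; exists (fun c => c * m) => c; [exact: divfK | exact: mulfK].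
apply: eq_card => c; rewrite !inE cS; have [->|//] := eqVneq c 0.
rewrite -cS mul0r (_ : #|_| = 2%N) //.
transitivity #|[set 0; m^-1]|; last by rewrite cards2 eq_sym invr_eq0 m0.
apply: eq_card => t; rewrite !inE (_ : _ + 0 = t * (t + m^-1) ^+ 2); last first.
  rewrite -mE; transitivity (t ^+ 3 + (m^-1)^+2 * t); first by field.
  by ring2.
by rewrite mulf_eq0 sqrf_eq0 addr_eq02.
Qed.

End Pencil.

(** * Points, planes and projectivities of PG(3,q) *)

Local Notation c4 k := (@Ordinal 4 k isT).

Lemma vec4E (a b c d : F) : (vec4 a b c d 0 (c4 0) = a) * (vec4 a b c d 0 (c4 1) = b)
  * (vec4 a b c d 0 (c4 2) = c) * (vec4 a b c d 0 (c4 3) = d).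
Proof. by rewrite !mxE. Qed.

Lemma row4P (u v : 'rV[F]_4) : u 0 (c4 0) = v 0 (c4 0) -> u 0 (c4 1) = v 0 (c4 1) ->
  u 0 (c4 2) = v 0 (c4 2) -> u 0 (c4 3) = v 0 (c4 3) -> u = v.
Proof.
move=> e0 e1 e2 e3; apply/rowP => -[[|[|[|[|//]]]] h].
- by rewrite (_ : Ordinal h = c4 0) //; apply: val_inj.
- by rewrite (_ : Ordinal h = c4 1) //; apply: val_inj.
- by rewrite (_ : Ordinal h = c4 2) //; apply: val_inj.
- by rewrite (_ : Ordinal h = c4 3) //; apply: val_inj.
Qed.

Definition row4 (X : 'M[F]_2) : 'rV[F]_4 := vec4 (X 0 0) (X 0 1) (X 1 0) (X 1 1).
Definition toM (x : 'rV[F]_4) : 'M[F]_2 :=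
  mk2 (x 0 (c4 0)) (x 0 (c4 1)) (x 0 (c4 2)) (x 0 (c4 3)).

Lemma row4K : cancel row4 toM.
Proof. by move=> X; apply: mx2P; rewrite mk2E vec4E. Qed.

Lemma toMK : cancel toM row4.
Proof. by move=> x; apply: row4P; rewrite vec4E mk2E. Qed.

Lemma row4D X Y : row4 (X + Y) = row4 X + row4 Y.
Proof. by apply: row4P; rewrite [RHS]mxE !vec4E mxE. Qed.

Lemma row4Z c X : row4 (c *: X) = c *: row4 X.
Proof. by apply: row4P; rewrite [RHS]mxE !vec4E mxE. Qed.

Lemma row4_0 : row4 0 = 0.
Proof. by rewrite -(scale0r (0 : 'M[F]_2)) row4Z scale0r. Qed.

Lemma row4_eq0 X : (row4 X == 0) = (X == 0).
Proof. by rewrite -row4_0 (can_eq row4K). Qed.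

Definition actrow (M : 'M[F]_2) (x : 'rV[F]_4) : 'rV[F]_4 := row4 (act M (toM x)).

Lemma actrow_linear M : linear (actrow M).
Proof.
move=> c x y; rewrite /actrow -row4Z -actZ -row4D -actD; congr (row4 (act M _)).
by apply: (can_inj row4K); rewrite row4D row4Z !toMK.
Qed.

HB.instance Definition _ M :=
  GRing.isLinear.Build F 'rV[F]_4 'rV[F]_4 *:%R (actrow M) (actrow_linear M).

Definition cubmx (M : 'M[F]_2) : 'M[F]_4 := lin1_mx (actrow M).

Lemma mul_cubmx X M : row4 X *m cubmx M = row4 (act M X).
Proof. by rewrite mul_rV_lin1 /= /actrow row4K. Qed.

Lemma eq_mul_row4 (A B : 'M[F]_4) :
  (forall X, row4 X *m A = row4 X *m B) -> A = B.
Proof.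
by move=> h; apply/row_matrixP => i; rewrite !rowE -[delta_mx _ _]toMK h.
Qed.

Lemma cubmxM M N : cubmx M *m cubmx N = cubmx (M *m N).
Proof. by apply: eq_mul_row4 => X; rewrite mulmxA !mul_cubmx actM. Qed.

Lemma cubmx1 : cubmx 1%:M = 1%:M.
Proof. by apply: eq_mul_row4 => X; rewrite mul_cubmx act1 mulmx1. Qed.

Lemma cubmx_unit M : M \in unitmx -> cubmx M \in unitmx.
Proof.
move=> uM; have : cubmx M *m cubmx (invmx M) = 1%:M by rewrite cubmxM mulmxV // cubmx1.
by case/mulmx1_unit.
Qed.

Definition ppt X : 'M[F]_4 := pt (row4 X).

Lemma ppt_eq X Y : X != 0 -> (ppt X == ppt Y) = sim X Y.
Proof.
move=> X0; apply/eqP/simP => [/genmxP/andP[]|[c c0 ->]]; last first.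
  by apply/genmxP; rewrite row4Z; apply/eqmxP; apply: eqmx_sym; apply: eqmx_scale.
move=> /sub_rVP[a ea] /sub_rVP[b eb]; exists b.
  apply: contraNneq X0 => b0; rewrite -row4_eq0 ea eb b0 scale0r scaler0 //.
by apply: (can_inj row4K); rewrite row4Z.
Qed.

Lemma is_point_ppt X : X != 0 -> is_point (ppt X).
Proof.
rewrite -row4_eq0 => X0; rewrite /is_point /subsp /ppt /pt genmx_id eqxx andbT.
by rewrite mxrank_gen rank_rV X0.
Qed.

Lemma is_pointP P : is_point P -> exists2 X, X != 0 & P = ppt X.
Proof.
case/andP=> /eqP rP /eqP eP.
have P0 : P != 0 by rewrite -mxrank_eq0 rP.
have v0 : nz_row P != 0 by rewrite nz_row_eq0.
exists (toM (nz_row P)); first by rewrite -row4_eq0 toMK.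
rewrite -{1}eP /ppt /pt toMK; apply/genmxP; apply/andP; split; last exact: nz_row_sub.
by have := mxrank_leqif_sup (nz_row_sub P); rewrite rP rank_rV v0 => -[_ <-].
Qed.

Lemma sub_ppt X n (A : 'M[F]_(n, 4)) : (ppt X <= A)%MS = (row4 X <= A)%MS.
Proof. by rewrite genmxE. Qed.

Lemma PtE t : Pt t = ppt (cpt (Some t)).
Proof. by rewrite /Pt /ppt /row4 !mk2E. Qed.

Lemma PinfE : Pinf F = ppt (cpt None).
Proof. by rewrite /Pinf /ppt /row4 !mk2E. Qed.

Lemma exists_option (T : finType) (p : pred (option T)) :
  [exists o, p o] = [exists t, p (Some t)] || p None.
Proof.
apply/existsP/orP => [[[t|] h]|[/existsP[t h]|h]].
- by left; apply/existsP; exists t.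
- by right.
- by exists (Some t).
- by exists None.
Qed.

Lemma cpt_neq0 o : cpt o != 0.
Proof.
apply/eqP => e; have := root_cpt o (if o is None then Some 0 else None).
by rewrite e /root /form !mxE !mul0r !addr0 !mulr0 addr0 eqxx; case: (o).
Qed.

Lemma onC_ppt X : onC (ppt X) = isC X.
Proof.
rewrite /onC /isC (exists_option (fun o => sim (cpt o) X)) PinfE eq_sym ppt_eq ?cpt_neq0 //.
by congr (_ || _); apply: eq_existsb => t; rewrite PtE eq_sym ppt_eq ?cpt_neq0.
Qed.

Lemma sim_cpt_inj o o' : sim (cpt o) (cpt o') -> o = o'.
Proof.
by move=> s; have := root_sim o s; rewrite !root_cpt eqxx => /eqP.
Qed.

(** With plane coordinates reversed, the osculating plane at a parameter is [pl] of the curve point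
    itself, and incidence is the vanishing of [bil]. *)
Definition rev4 (X : 'M[F]_2) : 'rV[F]_4 := vec4 (X 1 1) (X 1 0) (X 0 1) (X 0 0).
Definition pl X : 'M[F]_4 := plane_eq (rev4 X).

Lemma rev4Z c X : rev4 (c *: X) = c *: rev4 X.
Proof. by apply: row4P; rewrite [RHS]mxE !vec4E mxE. Qed.

Lemma rev4_inj : injective rev4.
Proof.
move=> X Y e; have e' i := congr1 (fun u : 'rV[F]_4 => u 0 i) e.
by have := (e' (c4 0), e' (c4 1), e' (c4 2), e' (c4 3)); rewrite /= !vec4E;
   case=> [[[h0 h1] h2] h3]; apply: mx2P.
Qed.

Lemma rev4_eq0 X : (rev4 X == 0) = (X == 0).
Proof.
have e : rev4 0 = 0 by rewrite -(scale0r (0 : 'M[F]_2)) rev4Z scale0r.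
by rewrite -{1}e (inj_eq rev4_inj).
Qed.

Lemma row4_rev4 Z X : (row4 Z *m (rev4 X)^T == 0) = (bil Z X == 0).
Proof.
have -> : row4 Z *m (rev4 X)^T = (bil Z X)%:M.
  apply/matrixP => i j; rewrite !ord1 !mxE !big_ord_recl big_ord0 /= addr0 /bil.
  by rewrite !mxE /= !addrA.
by rewrite -scalemx1 scaler_eq0 oner_eq0 orbF.
Qed.

Lemma sub_pl n (A : 'M[F]_(n, 4)) X : (A <= pl X)%MS = (A *m (rev4 X)^T == 0).
Proof. by rewrite genmxE sub_kermx. Qed.

Lemma rank_kermx_row (a : 'rV[F]_4) : a != 0 -> \rank (kermx a^T) = 3%N.
Proof. by move=> a0; rewrite mxrank_ker mxrank_tr rank_rV a0. Qed.

(** The row vectors annihilating a plane form a space of rank 1; if the planes agree, it contains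
    both [rev4 X] and [rev4 Y]. *)
Lemma pl_eq X Y : X != 0 -> (pl X == pl Y) = sim X Y.
Proof.
move=> X0; apply/eqP/simP => [e|[c c0 ->]]; last first.
  apply/genmxP; apply/andP; rewrite !sub_kermx rev4Z; split.
    by rewrite linearZ /= -scalemxAr mulmx_ker scaler0.
  have := mulmx_ker (c *: rev4 X)^T; rewrite [in X in _ *m X]linearZ /= -scalemxAr.
  by move/eqP; rewrite scaler_eq0 (negbTE c0).
pose N := (kermx (rev4 X)^T)^T.
have h1 : (rev4 X <= kermx N)%MS.
  by rewrite sub_kermx -trmx_eq0 trmx_mul !trmxK mulmx_ker.
have h2 : (rev4 Y <= kermx N)%MS.
  rewrite sub_kermx -trmx_eq0 trmx_mul !trmxK -sub_pl -e /pl /plane_eq genmxE.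
  exact: submx_refl.
have rN : \rank (kermx N) = 1%N.
  by rewrite mxrank_ker mxrank_tr rank_kermx_row ?rev4_eq0.
have h3 : (kermx N <= rev4 X)%MS.
  have := mxrank_leqif_sup h1; rewrite rN rank_rV rev4_eq0 X0 => -[_ <-] //.
have /sub_rVP[c cE] := submx_trans h2 h3.
have Y0 : Y != 0.
  apply/eqP => Y0; have := congr1 (fun A : 'M[F]_4 => \rank A) e.
  rewrite /pl /plane_eq !mxrank_gen rank_kermx_row ?rev4_eq0 // Y0.
  have /eqP -> : rev4 0 == 0 by rewrite rev4_eq0.
  by rewrite trmx0 mxrank_ker mxrank0.
exists c; last by apply: rev4_inj; rewrite cE rev4Z.
by apply: contraNneq Y0 => c0; rewrite -rev4_eq0 cE c0 scale0r.
Qed.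

Lemma is_plane_pl X : X != 0 -> is_plane (pl X).
Proof.
rewrite -rev4_eq0 => X0; rewrite /is_plane /subsp /pl /plane_eq genmx_id eqxx andbT.
by rewrite mxrank_gen rank_kermx_row.
Qed.

Lemma is_planeP Y : is_plane Y -> exists2 X, X != 0 & Y = pl X.
Proof.
case/andP=> /eqP rY /eqP eY.
have K0 : kermx Y^T != 0 by rewrite -mxrank_eq0 mxrank_ker mxrank_tr rY.
have v0 : nz_row (kermx Y^T) != 0 by rewrite nz_row_eq0.
set v := nz_row _ in v0.
have [X XE] : exists X, v = rev4 X.
  exists (mk2 (v 0 (c4 3)) (v 0 (c4 2)) (v 0 (c4 1)) (v 0 (c4 0))).
  by apply: row4P; rewrite !vec4E !mk2E.
have X0 : X != 0 by rewrite -rev4_eq0 -XE.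
exists X => //; rewrite -{1}eY /pl /plane_eq; apply/genmxP.
have sYX : (Y <= kermx (rev4 X)^T)%MS.
  rewrite sub_kermx -XE -trmx_eq0 trmx_mul trmxK -sub_kermx; exact: nz_row_sub.
have := mxrank_leqif_eq sYX; rewrite rY rank_kermx_row ?rev4_eq0 //.
by case=> _ <-.
Qed.

Lemma gamma_planeE t : gamma_plane t = pl (cpt (Some t)).
Proof.
rewrite /gamma_plane /pl; congr plane_eq; apply: row4P; rewrite !vec4E !mk2E //; ring2.
Qed.

Lemma gamma_infE : gamma_inf F = pl (cpt None).
Proof. by rewrite /gamma_inf /pl; congr plane_eq; apply: row4P; rewrite !vec4E !mk2E. Qed.

Lemma is_Gamma_pl X : is_Gamma_plane (pl X) = isC X.
Proof.
rewrite /is_Gamma_plane /isC (exists_option (fun o => sim (cpt o) X)).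
rewrite gamma_infE eq_sym pl_eq ?cpt_neq0 //; congr (_ || _).
by apply: eq_existsb => t; rewrite gamma_planeE eq_sym pl_eq ?cpt_neq0.
Qed.

Lemma bilC X Y : bil X Y = bil Y X.
Proof. by rewrite /bil; ring. Qed.

(** For [X] a point this is incidence with an osculating plane; for [X] a plane, incidence with a
    point of the cubic. Hence [nGamma] and [nC] both become [nroots]. *)
Lemma root_bil X o : root X o = (bil X (cpt o) == 0).
Proof.
by rewrite /root; case: o => [t|]; rewrite /form /bil /= !mk2E; congr (_ == _); ring.
Qed.

Lemma is_GammaP Y : is_Gamma_plane Y -> exists o, Y = pl (cpt o).
Proof.
case/orP => [/existsP[t /eqP ->]|/eqP ->]; first by exists (Some t); rewrite gamma_planeE.
by exists None; rewrite gamma_infE.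
Qed.

Lemma onCP P : onC P -> exists o, P = ppt (cpt o).
Proof.
case/orP => [/existsP[t /eqP ->]|/eqP ->]; first by exists (Some t); rewrite PtE.
by exists None; rewrite PinfE.
Qed.

Lemma isC_cpt o : isC (cpt o).
Proof. by apply/existsP; exists o; apply: sim_refl. Qed.

Lemma nGamma_ppt X : nGamma (ppt X) = nroots X.
Proof.
rewrite /nGamma /nroots -(card_imset (f := fun o => pl (cpt o))); last first.
  by move=> o o' /eqP; rewrite pl_eq ?cpt_neq0 // => /sim_cpt_inj.
apply: eq_card => Y; rewrite inE; apply/andP/imsetP => [[/is_GammaP[o ->]]|[o]].
  by rewrite sub_ppt sub_pl row4_rev4 -root_bil => rX; exists o; rewrite ?inE.
rewrite inE => rX ->; rewrite is_Gamma_pl isC_cpt.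
by rewrite sub_ppt sub_pl row4_rev4 -root_bil.
Qed.

Lemma nC_pl X : nC (pl X) = nroots X.
Proof.
rewrite /nC /nroots -(card_imset (f := fun o => ppt (cpt o))); last first.
  by move=> o o' /eqP; rewrite ppt_eq ?cpt_neq0 // => /sim_cpt_inj.
apply: eq_card => Y; rewrite inE; apply/andP/imsetP => [[/onCP[o ->]]|[o]].
  by rewrite sub_ppt sub_pl row4_rev4 bilC -root_bil => rX; exists o; rewrite ?inE.
rewrite inE => rX ->; rewrite onC_ppt isC_cpt.
by rewrite sub_ppt sub_pl row4_rev4 bilC -root_bil.
Qed.

Lemma sub_line2P (w u v : 'rV[F]_4) :
  reflect (exists a b, w = a *: u + b *: v) (w <= line2 u v)%MS.
Proof.
rewrite genmxE -addsmxE; apply: (iffP sub_addsmxP) => [[[A B] /= ->]|[a [b ->]]].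
  exists (A 0 0), (B 0 0).
  by rewrite -!mul_scalar_mx -!mx11_scalar.
by exists (a%:M, b%:M); rewrite /= !mul_scalar_mx.
Qed.

(** In characteristic 2 the tangents form a regulus of the quadric of singular matrices: on the
    tangent at [r] the first row is [r ^+ 2] times the second, and on the tangent at infinity the
    second row is zero. *)
Lemma on_tangent_ppt X : on_tangent (ppt X) = (\det X == 0).
Proof.
apply/idP/idP.
  case/orP => [/existsP[t]|]; rewrite sub_ppt => /sub_line2P[a [b /(congr1 toM)]];
  rewrite row4K => ->; apply/eqP; rewrite det2E !mk2E ![in LHS]mxE /=; ring2.
rewrite det2E addr_eq02 => /eqP e; apply/orP.
have [x3|x3] := eqVneq (X 1 1) 0; last first.
  have [r rE] := sqr_surj2 (X 0 1 / X 1 1).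
  left; apply/existsP; exists r; rewrite sub_ppt; apply/sub_line2P.
  exists (X 1 1), (X 1 0 + r * X 1 1).
  have x1 : X 0 1 = r ^+ 2 * X 1 1 by rewrite rE divfK.
  have x0 : X 0 0 = r ^+ 2 * X 1 0.
    by apply: (mulIf x3); rewrite e x1; ring.
  by apply: row4P; rewrite /row4 [in RHS]mxE ![in X in _ + X]mxE ![in X in X + _]mxE /= !vec4E ?x0 ?x1; ring2.
have := e; rewrite x3 mulr0 => /esym/eqP; rewrite mulf_eq0.
have [x2 _|x2] := eqVneq (X 1 0) 0.
  right; rewrite sub_ppt; apply/sub_line2P; exists (X 0 0), (X 0 1).
  by apply: row4P; rewrite !mxE /= ?x2 ?x3; ring.
rewrite orbF => /eqP x1; have [r rE] := sqr_surj2 (X 0 0 / X 1 0).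
have x0 : X 0 0 = r ^+ 2 * X 1 0 by rewrite rE divfK.
left; apply/existsP; exists r; rewrite sub_ppt; apply/sub_line2P; exists 0, (X 1 0).
by apply: row4P; rewrite !mxE /= ?x0 ?x1 ?x3; ring2.
Qed.

Lemma T_point_ppt X : X != 0 -> T_point (ppt X) = ctype 2 X.
Proof.
by move=> X0; rewrite /T_point is_point_ppt // onC_ppt on_tangent_ppt ctype2E X0.
Qed.

Lemma muGamma_ppt k X : X != 0 -> muGamma_point k (ppt X) = ctype k X.
Proof.
by move=> X0; rewrite /muGamma_point is_point_ppt // onC_ppt nGamma_ppt /ctype X0.
Qed.

(** Osculating planes meet the cubic in a single point, so for [k != 1] they are excluded
    automatically. *)
Lemma dC_pl k X : X != 0 -> k != 1%N -> dC_plane k (pl X) = ctype k X.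
Proof.
move=> X0 k1; rewrite /dC_plane is_plane_pl // nC_pl /ctype X0 /=.
case iC: (isC X) => //=; rewrite (isC_nroots iC).
by rewrite eq_sym (negbTE k1).
Qed.

Lemma onebar_pl X : X != 0 -> onebar_plane (pl X) = ctype 1 X.
Proof. by move=> X0; rewrite /onebar_plane is_plane_pl // is_Gamma_pl nC_pl /ctype X0. Qed.

(** * Images of the line and their incidences *)

Lemma ellE mu : ell mu = line2 (row4 (lpt mu (Some 0))) (row4 (lpt mu None)).
Proof. by rewrite /ell /row4 !mk2E. Qed.

Lemma sub_ell mu X : (row4 X <= ell mu)%MS = inell mu X.
Proof.
rewrite ellE; apply/sub_line2P/idP => [[a [b]]|h].
  rewrite -!row4Z -row4D => /(can_inj row4K) ->.
  by rewrite /inell !mxE /= !(mulr0, mulr1, addr0, add0r) mulrC !eqxx.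
by exists (X 1 1), (X 0 0); rewrite -!row4Z -row4D addrC -lpt_ell.
Qed.

Definition lineM mu M := proj_act (cubmx M) (ell mu).

Lemma sub_lineM mu M X : M \in unitmx ->
  (row4 X <= lineM mu M)%MS = inell mu (act (invmx M) X).
Proof.
move=> uM; rewrite genmxE -sub_ell -mul_cubmx.
rewrite -{1}(actVK X uM) -mul_cubmx submxMfree ?row_free_unit ?cubmx_unit //.
by rewrite mul_cubmx.
Qed.

Lemma lineM_sub mu M n (A : 'M[F]_(n, 4)) : (lineM mu M <= A)%MS =
  (row4 (act M (lpt mu None)) <= A)%MS && (row4 (act M (lpt mu (Some 0))) <= A)%MS.
Proof.
rewrite genmxE ellE (eqmxMr _ (genmxE _)) mul_col_mx col_mx_sub andbC.
by rewrite !mul_cubmx.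
Qed.

(** The form [bil] is invariant up to a factor, so [M] can be moved from the line to the plane;
    [dual_ell] then turns the two incidences into membership in a line. *)
Lemma lineM_pl (mu : F) : mu != 0 -> exists2 D, D \in unitmx & forall M X, M \in unitmx ->
  (lineM mu M <= pl X)%MS = inell mu^-1 (act (invmx M *m D) X).
Proof.
move=> mu0; have [D uD hD] := dual_ell mu0; exists D => // M X uM.
have dM : \det M != 0 by rewrite -unit2E.
have h Y : (bil (act M Y) X == 0) = (bil (act (invmx M) X) Y == 0).
  by rewrite bilC -{1}(actVK X uM) bil_act mulf_eq0 expf_eq0 (negbTE dM).
by rewrite lineM_sub !sub_pl !row4_rev4 -actM hD (h (lpt mu None)) (h (lpt mu (Some 0))).
Qed.

Lemma lineM_eq mu M M0 : M \in unitmx -> M0 \in unitmx ->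
  (lineM mu M == lineM mu M0) =
  inell mu (act (M *m invmx M0) (lpt mu None)) &&
  inell mu (act (M *m invmx M0) (lpt mu (Some 0))).
Proof.
move=> uM uM0; rewrite -!actM -!(sub_lineM mu _ uM0) -lineM_sub.
apply/eqP/idP => [->|s]; first exact: submx_refl.
have rk N : N \in unitmx -> \rank (lineM mu N) = \rank (ell mu).
  by move=> uN; rewrite mxrank_gen mxrankMfree // row_free_unit cubmx_unit.
have := mxrank_leqif_eq s; rewrite !rk // => -[_ /esym]; rewrite eqxx => h.
have gen N : lineM mu N = <<lineM mu N>>%MS by rewrite /lineM /proj_act genmx_id.
by rewrite gen [RHS]gen; apply/genmxP.
Qed.

(** These matrices form a coset of the stabiliser counted in [card_stab_ell]. *)
Lemma card_lineM mu M0 : mu != 0 -> mu != 1 -> M0 \in unitmx ->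
  #|[set M | (M \in unitmx) && (lineM mu M == lineM mu M0)]| = (2 * #|F|.-1)%N.
Proof.
move=> mu0 mu1 uM0; rewrite -(card_stab_ell mu0 mu1).
have uM0' : invmx M0 \in unitmx by rewrite unitmx_inv.
rewrite -[RHS](on_card_preimset (onW_bij _ (conj_bij (unitmx1 _ _) uM0'))).
apply: eq_card => M; rewrite !inE mul1mx unitmx_mul uM0' andbT.
by case uM: (M \in unitmx) => //=; rewrite lineM_eq.
Qed.

Lemma proj_act_ppt M X : proj_act (cubmx M) (ppt X) = ppt (act M X).
Proof.
rewrite /proj_act /ppt /pt -mul_cubmx; apply/genmxP/eqmxP.
exact: eqmxMr (genmxE _).
Qed.

Lemma cubmx_Gq M : M \in unitmx -> cubmx M \in Gq F.
Proof.
move=> uM; rewrite inE cubmx_unit //=; apply/forallP => P; apply/implyP.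
case/is_pointP => X X0 ->; rewrite proj_act_ppt !onC_ppt isC_act //.
Qed.

(** * Projectivities preserving the twisted cubic *)

Lemma poly_eq0_all (p : {poly F}) : (size p <= #|F|)%N ->
  (forall t, p.[t] = 0) -> p = 0.
Proof.
move=> sp h; apply/eqP; apply: contraLR sp => p0; rewrite -ltnNge cardE.
apply: max_poly_roots => //; last by rewrite enum_uniq.
by apply/allP => t _; apply/eqP.
Qed.

Lemma mulrow4E n (x : 'rV[F]_4) (A : 'M[F]_(4, n)) j : (x *m A) 0 j =
  x 0 (c4 0) * A (c4 0) j + x 0 (c4 1) * A (c4 1) j
  + x 0 (c4 2) * A (c4 2) j + x 0 (c4 3) * A (c4 3) j.
Proof.
rewrite mxE !big_ord_recl big_ord0 addr0 !addrA.
by congr (_ + _ + _ + _); congr (x _ _ * A _ _); apply: val_inj.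
Qed.

(** Coordinate [j] of the image of the curve point with parameter [t], as a polynomial in [t];
    coefficients start at the constant term. *)
Definition colpoly n (A : 'M[F]_(4, n)) j : {poly F} :=
  Poly [:: A (c4 3) j; A (c4 2) j; A (c4 1) j; A (c4 0) j].

Lemma size_colpoly n (A : 'M[F]_(4, n)) j : (size (colpoly A j) <= 4)%N.
Proof. exact: size_Poly. Qed.

Lemma colpolyE n (A : 'M[F]_(4, n)) j t :
  (colpoly A j).[t] = (row4 (cpt (Some t)) *m A) 0 j.
Proof. by rewrite horner_Poly /= mulrow4E !vec4E !mk2E; ring. Qed.

(** The affine points of the cubic span the space: a polynomial of degree at most 3 vanishing on at
    least 4 field elements is zero. *)
Lemma mul_cpt_eq0 n (A : 'M[F]_(4, n)) : (4 <= #|F|)%N ->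
  (forall t, row4 (cpt (Some t)) *m A = 0) -> A = 0.
Proof.
move=> q4 h; apply/matrixP => i j; rewrite [RHS]mxE.
have /polyP p0 : colpoly A j = 0.
  apply: poly_eq0_all => [|t]; first exact: leq_trans (size_colpoly A j) q4.
  by rewrite colpolyE h mxE.
have e k := p0 k; have := (e 0%N, e 1%N, e 2%N, e 3%N).
rewrite !coef_Poly !coef0 /= => -[[[e0 e1] e2] e3].
case: i => [[|[|[|[|//]]]] hi].
- by rewrite (_ : Ordinal hi = c4 0) //; apply: val_inj.
- by rewrite (_ : Ordinal hi = c4 1) //; apply: val_inj.
- by rewrite (_ : Ordinal hi = c4 2) //; apply: val_inj.
- by rewrite (_ : Ordinal hi = c4 3) //; apply: val_inj.
Qed.

(* Dividing out gcds: [p0 = d a], [p1 = d b] with [a], [b] coprime forces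
   [a ^+ 2 %| d]. *)
Lemma twisted_cubic_param (p0 p1 p2 p3 : {poly F}) :
  p0 * p2 = p1 ^+ 2 -> p1 * p3 = p2 ^+ 2 ->
  (size p0 <= 4)%N -> (size p3 <= 4)%N -> p0 != 0 -> p3 != 0 ->
  (forall c, p1 <> c *: p0) ->
  exists (k : F) (a b : {poly F}), [/\ (size a <= 2)%N, (size b <= 2)%N &
    [/\ p0 = k *: a ^+ 3, p1 = k *: (a ^+ 2 * b), p2 = k *: (a * b ^+ 2)
      & p3 = k *: b ^+ 3]].
Proof.
move=> h02 h13 s0 s3 p00 p30 np.
have p10 : p1 != 0 by apply/eqP => p10; apply: (np 0); rewrite scale0r.
pose d := gcdp p0 p1.
have e0 : p0 = (p0 %/ d) * d by rewrite divpK // dvdp_gcdl.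
have e1 : p1 = (p1 %/ d) * d by rewrite divpK // dvdp_gcdr.
have cop : coprimep (p0 %/ d) (p1 %/ d) by rewrite coprimep_div_gcd // p00.
move: (p0 %/ d) (p1 %/ d) e0 e1 cop => a b e0 e1 cop.
move: (d) e0 e1 => {}d e0 e1.
have [a0 d0] : a != 0 /\ d != 0.
  by move: p00; rewrite e0 mulf_eq0 negb_or => /andP[].
have b0 : b != 0 by move: p10; rewrite e1 mulf_eq0 negb_or => /andP[].
have k1 : d * b ^+ 2 = a * p2.
  by apply: (mulfI d0); transitivity (p1 ^+ 2); [rewrite e1; ring | rewrite -h02 e0; ring].
have /dvdpP[e de] : a %| d.
  by rewrite -(Gauss_dvdpl _ (coprimep_expr 2 cop)) k1 dvdp_mulIl.
have e00 : e != 0 by move: d0; rewrite de mulf_eq0 negb_or => /andP[].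
have k2 : p2 = e * b ^+ 2.
  by apply: (mulfI a0); rewrite -k1 de; ring.
have k3 : e * b ^+ 3 = a * p3.
  apply: (mulfI (mulf_neq0 b0 e00)); transitivity (p2 ^+ 2).
    by rewrite k2; ring.
  by rewrite -h13 e1 de; ring.
have /dvdpP[k ek] : a %| e.
  by rewrite -(Gauss_dvdpl _ (coprimep_expr 3 cop)) k3 dvdp_mulIl.
have k0 : k != 0 by move: e00; rewrite ek mulf_eq0 negb_or => /andP[].
have q0 : p0 = k * a ^+ 3 by rewrite e0 de ek; ring.
have q3 : p3 = k * b ^+ 3 by apply: (mulfI a0); rewrite -k3 ek; ring.
have q1 : p1 = k * (a ^+ 2 * b) by rewrite e1 de ek; ring.
have q2 : p2 = k * (a * b ^+ 2) by rewrite k2 ek; ring.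
(* By degrees, [deg k + 3 deg c] is at most 3, so [c] has degree at most 1 and one of [k], [c] is
   constant. *)
have sz (c : {poly F}) : c != 0 -> (size (k * c ^+ 3)%R <= 4)%N ->
    (size c <= 2)%N /\ (size k = 1%N \/ size c = 1%N).
  move=> c0; rewrite size_mul ?expf_neq0 //; have := size_exp c 3.
  have : (0 < size k)%N by rewrite size_poly_gt0.
  have : (0 < size c)%N by rewrite size_poly_gt0.
  have : (0 < size (c ^+ 3)%R)%N by rewrite size_poly_gt0 expf_neq0.
  by move: (size k) (size c) (size (c ^+ 3)%R) => m n l; clear; lia.
have [sa ka] : (size a <= 2)%N /\ (size k = 1%N \/ size a = 1%N).
  by apply: sz; rewrite -?q0.
have [sb kb] : (size b <= 2)%N /\ (size k = 1%N \/ size b = 1%N).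
  by apply: sz; rewrite -?q3.
have [/size_poly1P[c _ kc]|k1n] := boolP (size k == 1%N).
  by exists c, a, b; rewrite q0 q1 q2 q3 kc !mul_polyC.
(* If [k] is not constant, then [a] and [b] both are, which makes [p1] a scalar multiple of [p0]. *)
have /eqP/size_poly1P[x x0 ax] : size a = 1%N by case: ka k1n => // ->.
have /eqP/size_poly1P[y _ bx] : size b = 1%N by case: kb k1n => // ->.
case: (np (y / x)); rewrite q0 q1 ax bx -mul_polyC.
have -> : (y / x)%:P * (k * x%:P ^+ 3) = k * (x%:P ^+ 2 * ((y / x) * x)%:P).
  by rewrite polyCM; ring.
by rewrite divfK.
Qed.

(** The image coordinates satisfy the quadric equations as polynomials, so [twisted_cubic_param]
    writes them through two polynomials of degree at most 1, whose coefficients are the entries of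
    [M]. *)
Lemma Gq_cubmx A : (8 <= #|F|)%N -> A \in Gq F ->
  exists (k : F) (M : 'M[F]_2), [/\ k != 0, M \in unitmx & A = k *: cubmx M].
Proof.
move=> q8; rewrite inE => /andP[uA /forallP hA].
have q4 : (4 <= #|F|)%N by apply: leq_trans q8.
have q7 : (7 <= #|F|)%N by apply: leq_trans q8.
pose p j := colpoly A j.
have sp j : (size (p j) <= 4)%N by apply: size_colpoly.
have hC t : exists o c, row4 (cpt (Some t)) *m A = c *: row4 (cpt o).
  have := hA (ppt (cpt (Some t))); rewrite is_point_ppt ?cpt_neq0 // onC_ppt isC_cpt.
  rewrite /= => /eqP hc; have : onC (proj_act A (ppt (cpt (Some t)))) by rewrite hc.
  case/onCP => o; rewrite /proj_act /ppt /pt => /genmxP/andP[s _].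
  have {}s : (row4 (cpt (Some t)) *m A <= row4 (cpt o))%MS.
    by apply: submx_trans s; rewrite submxMr // genmxE.
  by case/sub_rVP: s => c ec; exists o, c.
have rel t : (p (c4 0)).[t] * (p (c4 2)).[t] = (p (c4 1)).[t] ^+ 2 /\
             (p (c4 1)).[t] * (p (c4 3)).[t] = (p (c4 2)).[t] ^+ 2.
  have [o [c e]] := hC t; rewrite !colpolyE e -row4Z !vec4E.
  by case: (o) => [s|]; rewrite !mxE /=; split; ring.
have sz (u v w z : {poly F}) : (size u <= 4)%N -> (size v <= 4)%N ->
    (size w <= 4)%N -> (size z <= 4)%N -> (size (u * v - w * z)%R <= 7)%N.
  move=> su sv sw sz; apply: leq_trans (size_polyD _ _) _; rewrite size_polyN geq_max.
  by apply/andP; split; apply: leq_trans (size_polyMleq _ _) _;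
     rewrite -subn1 leq_subLR; [exact: (leq_add su sv) | exact: (leq_add sw sz)].
have r1 : p (c4 0) * p (c4 2) = p (c4 1) ^+ 2.
  apply/eqP; rewrite -subr_eq0; apply/eqP; apply: poly_eq0_all => [|t].
    by rewrite expr2; apply: leq_trans q7; apply: sz.
  by rewrite hornerD hornerN hornerM horner_exp; have [-> _] := rel t; rewrite subrr.
have r2 : p (c4 1) * p (c4 3) = p (c4 2) ^+ 2.
  apply/eqP; rewrite -subr_eq0; apply/eqP; apply: poly_eq0_all => [|t].
    by rewrite expr2; apply: leq_trans q7; apply: sz.
  by rewrite hornerD hornerN hornerM horner_exp; have [_ ->] := rel t; rewrite subrr.
(* As [A] is invertible, no nontrivial linear relation holds among the image coordinates; this gives
   the nondegeneracy conditions below. *)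
have ind (c : 'cV[F]_4) : (forall t, row4 (cpt (Some t)) *m (A *m c) = 0) -> c = 0.
  by move/(mul_cpt_eq0 q4) => e; rewrite -(mulKmx uA c) e mulmx0.
have indE (c : 'rV[F]_4) t : (row4 (cpt (Some t)) *m (A *m c^T)) = 
    ((p (c4 0)).[t] * c 0 (c4 0) + (p (c4 1)).[t] * c 0 (c4 1)
     + (p (c4 2)).[t] * c 0 (c4 2) + (p (c4 3)).[t] * c 0 (c4 3))%:M.
  apply/matrixP => i j; rewrite !ord1 mulmxA mulrow4E -!colpolyE [RHS]mxE eqxx mulr1n.
  by rewrite !mxE.
have pn0 : p (c4 0) != 0.
  apply/eqP => e; have : (vec4 1 0 0 0 : 'rV[F]_4)^T = 0.
    apply: ind => t; rewrite indE e !vec4E horner0.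
    by rewrite !(mul0r, mulr0, addr0) raddf0.
  by move/(congr1 (fun u : 'cV[F]_4 => u (c4 0) 0)); rewrite !mxE /= => /eqP; rewrite oner_eq0.
have pn3 : p (c4 3) != 0.
  apply/eqP => e; have : (vec4 0 0 0 1 : 'rV[F]_4)^T = 0.
    apply: ind => t; rewrite indE e !vec4E horner0.
    by rewrite !(mul0r, mulr0, addr0) raddf0.
  by move/(congr1 (fun u : 'cV[F]_4 => u (c4 3) 0)); rewrite !mxE /= => /eqP; rewrite oner_eq0.
have np c : p (c4 1) <> c *: p (c4 0).
  move=> e; have : (vec4 (- c) 1 0 0 : 'rV[F]_4)^T = 0.
    apply: ind => t; rewrite indE e !vec4E hornerZ.
    by rewrite (_ : _ + _ = 0) ?raddf0 //; ring.
  by move/(congr1 (fun u : 'cV[F]_4 => u (c4 1) 0)); rewrite !mxE /= => /eqP; rewrite oner_eq0.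
have [k [a [b [sa sb [e0 e1 e2 e3]]]]] :=
  twisted_cubic_param r1 r2 (sp _) (sp _) pn0 pn3 np.
pose M := mk2 a`_1 b`_1 a`_0 b`_0.
have ev (u : {poly F}) t : (size u <= 2)%N -> u.[t] = u`_1 * t + u`_0.
  move=> su; rewrite (horner_coef_wide _ su) !big_ord_recl big_ord0 /= addr0.
  by rewrite expr0 expr1 mulr1 addrC.
have AE : A = k *: cubmx M.
  apply/eqP; rewrite -subr_eq0; apply/eqP; apply: (mul_cpt_eq0 q4) => t.
  rewrite mulmxBr -scalemxAr mul_cubmx [in act _ _]cptE act_rk1 /mulv /swp /= !mxE /= !mulr1.
  rewrite -!ev // -row4Z; apply/eqP; rewrite subr_eq0; apply/eqP.
  by apply: row4P; rewrite -colpolyE vec4E;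
    [rewrite -/(p (c4 0)) e0 | rewrite -/(p (c4 1)) e1
    | rewrite -/(p (c4 2)) e2 | rewrite -/(p (c4 3)) e3];
    rewrite !mxE /= !(hornerZ, hornerM, horner_exp); ring.
have k0 : k != 0 by apply: contraNneq pn0 => k0; rewrite e0 k0 scale0r.
exists k, M; split=> //.
(* The identity matrix, as a point, is [k *: act M Y] for some [Y]; comparing 2x2 determinants shows
   that [\det M] is nonzero. *)
have := congr1 (fun u => \det (toM u)) (mulmxKV uA (row4 1%:M)).
rewrite /= {2}AE -scalemxAr -[_ *m invmx A]toMK mul_cubmx -row4Z !row4K.
rewrite detZ2 det_act det1 unit2E => h; apply: contra_eq_neq h => ->.
by rewrite expr0n /= mul0r mulr0 eq_sym oner_eq0.
Qed.

Lemma orbitP mu L : (8 <= #|F|)%N ->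
  reflect (exists2 M, M \in unitmx & L = lineM mu M) (L \in orbitO mu).
Proof.
move=> q8; rewrite inE; apply: (iffP existsP) => [[A /andP[AG /eqP ->]]|[M uM ->]].
  have [k [M [k0 uM ->]]] := Gq_cubmx q8 AG; exists M => //.
  rewrite /lineM /proj_act -scalemxAr; apply/genmxP/eqmxP.
  exact: eqmx_scale.
by exists (cubmx M); rewrite cubmx_Gq // eqxx.
Qed.

(** By [card_lineM] every line of the orbit arises from exactly [2 * #|F|.-1] matrices. *)
Lemma card_orbit_lines mu (R : pred 'M[F]_4) : (8 <= #|F|)%N -> mu != 0 -> mu != 1 ->
  (#|[set L in orbitO mu | R L]| * (2 * #|F|.-1) =
   #|[set M : 'M[F]_2 | (M \in unitmx) && R (lineM mu M)]|)%N.
Proof.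
move=> q8 mu0 mu1; rewrite -[RHS]sum1_card.
rewrite (partition_big (lineM mu) (fun L => (L \in orbitO mu) && R L)) /=; last first.
  move=> M; rewrite inE => /andP[uM ->]; rewrite andbT.
  by apply/(orbitP _ _ q8); exists M.
rewrite (eq_bigr (fun=> (2 * #|F|.-1)%N)) => [|L /andP[/(orbitP _ _ q8)[M0 uM0 ->] RL]].
  by rewrite sum_nat_const; congr (_ * _)%N; apply: eq_card => L; rewrite inE.
rewrite -(card_lineM mu0 mu1 uM0) -sum1_card; apply: eq_bigl => M.
rewrite !inE -andbA; case: (M \in unitmx) => //=.
by case: eqP => [->|_]; rewrite ?RL ?andbF.
Qed.

(** * Counting in the orbit of ell_mu *)

(** Treats points on a line and planes through it together: [obj] is [ppt] or [pl], and [N] carries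
    the incidence [R] to membership in the line of parameter [nu]. *)
Lemma card_line_objs (obj : 'M[F]_2 -> 'M[F]_4) (Q R : pred 'M[F]_4) k nu N :
  (forall X Y, X != 0 -> (obj X == obj Y) = sim X Y) ->
  (forall P, Q P -> exists2 X, X != 0 & P = obj X) ->
  (forall X, X != 0 -> Q (obj X) = ctype k X) ->
  N \in unitmx -> (forall X, R (obj X) = inell nu (act N X)) ->
  #|[set P | Q P && R P]| = ntype k nu.
Proof.
move=> obj_eq objP Qobj uN Robj.
have uN' : invmx N \in unitmx by rewrite unitmx_inv.
pose f o := obj (act (invmx N) (lpt nu o)).
have X0 o : act (invmx N) (lpt nu o) != 0 by rewrite act_eq0 // lpt_neq0.
rewrite /ntype -(card_imset (f := f)); last first.
  by move=> o o' /eqP; rewrite obj_eq // sim_act // => /sim_lpt_inj.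
apply: eq_card => P; rewrite inE; apply/andP/imsetP => [[QP RP]|[o]].
  have [X nX PE] := objP P QP; rewrite PE Qobj // Robj in QP RP *.
  have [|o s] := inellP nu _ RP; first by rewrite act_eq0.
  exists o; first by rewrite inE (ctype_sim _ s) ctype_act.
  by apply/eqP; rewrite obj_eq // -(sim_act _ _ uN) actVK.
rewrite inE => co ->; rewrite Qobj // ctype_act // Robj actVK //; split=> //.
by have := sim_refl (lpt nu o); rewrite sim_lpt ?lpt_neq0 // => /andP[].
Qed.

Lemma isC_inell (nu : F) N X : nu != 0 -> nu != 1 -> N \in unitmx -> X != 0 ->
  isC X -> inell nu (act N X) = false.
Proof.
move=> nu0 nu1 uN X0 iC; apply/negP => /inellP[|o s]; first by rewrite act_eq0.
by have := isC_lpt nu0 nu1 o; rewrite (isC_sim s) isC_act // iC.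
Qed.

Section Counts.
Variable mu : F.
Hypotheses (q8 : (8 <= #|F|)%N) (mu0 : mu != 0) (mu1 : mu != 1).

Let nu0 : mu^-1 != 0. Proof. by rewrite invr_eq0. Qed.
Let nu1 : mu^-1 != 1. Proof. by rewrite invr_eq1. Qed.

(** The substitution of [invmx M *m D] for [M] identifies the counts of [card_orbit_lines] and
    [card_meet_ell]. After cancelling [#|F|.-1], the factor 2 is the order of the stabiliser of the
    line modulo scalars. *)
Lemma card_orbit_objs nu k X D (R : pred 'M[F]_4) : D \in unitmx -> ctype k X ->
  (forall M, M \in unitmx -> R (lineM mu M) = inell nu (act (invmx M *m D) X)) ->
  (#|[set L in orbitO mu | R L]| * 2 = stab_size k * ntype k nu)%N.
Proof.
move=> uD cX hR.
apply/eqP; rewrite -(eqn_pmul2r q1_gt0) -mulnA card_orbit_lines // mulnAC.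
rewrite -(card_meet_ell nu cX); apply/eqP.
have b := bij_comp (conj_bij (unitmx1 F 2) uD) (inv_bij (@invmxK F 2)).
rewrite -[RHS](on_card_preimset (onW_bij _ b)); apply: eq_card => M.
rewrite !inE /= mul1mx unitmx_mul unitmx_inv uD andbT.
by case uM: (M \in unitmx) => //=; rewrite hR.
Qed.

Lemma P_cnt_orbit k (Q : pred 'M[F]_4) L : (forall P, Q P -> is_point P) ->
  (forall X, X != 0 -> Q (ppt X) = ctype k X) -> L \in orbitO mu ->
  P_cnt Q L = ntype k mu.
Proof.
move=> QP Qppt /(orbitP _ _ q8)[M uM ->].
apply: (@card_line_objs ppt _ (fun P => P <= lineM mu M)%MS _ _ (invmx M)) => //.
- exact: ppt_eq.
- by move=> P /QP/is_pointP.
- by rewrite unitmx_inv.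
- by move=> X; rewrite sub_ppt sub_lineM.
Qed.

Lemma Pi_cnt_orbit k (Q : pred 'M[F]_4) L : (forall Y, Q Y -> is_plane Y) ->
  (forall X, X != 0 -> Q (pl X) = ctype k X) -> L \in orbitO mu ->
  Pi_cnt Q L = ntype k mu^-1.
Proof.
move=> QP Qpl /(orbitP _ _ q8)[M uM ->]; have [D uD hD] := lineM_pl mu0.
apply: (@card_line_objs pl _ (fun Y => lineM mu M <= Y)%MS _ _ (invmx M *m D)) => //.
- exact: pl_eq.
- by move=> P /QP/is_planeP.
- by rewrite unitmx_mul unitmx_inv uM.
- by move=> X; rewrite hD.
Qed.

Lemma L_cnt_orbit k X : ctype k X ->
  (L_cnt (orbitO mu) (ppt X) * 2 = stab_size k * ntype k mu)%N.
Proof.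
move=> cX; apply: (@card_orbit_objs mu k X 1%:M (fun L => ppt X <= L)%MS) => //.
  exact: unitmx1.
by move=> M uM; rewrite sub_ppt sub_lineM // mulmx1.
Qed.

Lemma Lambda_cnt_orbit k X : ctype k X ->
  (Lambda_cnt (orbitO mu) (pl X) * 2 = stab_size k * ntype k mu^-1)%N.
Proof.
move=> cX; have [D uD hD] := lineM_pl mu0.
apply: (@card_orbit_objs mu^-1 k X D (fun L => L <= pl X)%MS) => //.
by move=> M uM; rewrite hD.
Qed.

Lemma C_point_notin L P : L \in orbitO mu -> C_point P -> (P <= L)%MS = false.
Proof.
move=> /(orbitP _ _ q8)[M uM ->] /andP[/is_pointP[X X0 ->]].
rewrite onC_ppt sub_ppt sub_lineM // => iC.
by rewrite isC_inell // unitmx_inv.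
Qed.

Lemma Gamma_plane_notin L Y : L \in orbitO mu -> is_Gamma_plane Y -> (L <= Y)%MS = false.
Proof.
move=> /(orbitP _ _ q8)[M uM ->] /is_GammaP[o ->].
have [D uD ->] // := lineM_pl mu0.
by rewrite isC_inell ?isC_cpt ?cpt_neq0 // unitmx_mul unitmx_inv uM.
Qed.

End Counts.

(** With two T-points, [ntype_roots] reads [N1 mu + 4 + 3 * ntype 3 mu = #|F| + 1]. *)
Lemma ntype3_rat (mu : F) : mu != 0 -> mu != 1 ->
  ((ntype 3 mu)%:R : rat) = (#|F|%:R - 3 - (N1 mu)%:R) / 3.
Proof.
move=> mu0 mu1; have := ntype_roots mu0 mu1; rewrite ntype1 // ntype2 // => e.
have -> : #|F| = (N1 mu + 3 * ntype 3 mu + 3)%N by lia.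
by rewrite (natrD _ (_ + _)) (natrD _ (N1 mu)) (natrM _ 3); field.
Qed.

(** Combining [ntype_total] with [ntype_roots] gives [ntype 0 mu = 2 * ntype 3 mu + 2]. *)
Lemma ntype0_rat (mu : F) : mu != 0 -> mu != 1 ->
  ((ntype 0 mu)%:R : rat) = 2%:R * (#|F|%:R - (N1 mu)%:R) / 3.
Proof.
move=> mu0 mu1; have := ntype_roots mu0 mu1; have := ntype_total mu0 mu1.
rewrite ntype1 // ntype2 // => e e'.
have -> : #|F| = (N1 mu + 3 * ntype 3 mu + 3)%N by lia.
have -> : ntype 0 mu = (2 * ntype 3 mu + 2)%N by lia.
by rewrite (natrD _ (2 * _)) (natrD _ (_ + _)) (natrD _ (N1 mu)) (natrM _ 2) (natrM _ 3); field.
Qed.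

End Char2.

(** Every element is fixed by the power [#|F|]; for an even exponent, applied to -1, this gives 1 =
    -1. *)
Lemma even_two0 (F : finFieldType) : ~~ odd #|F| -> 2%:R = 0 :> F.
Proof.
move=> ev; have := expf_card (-1 : F); rewrite -signr_odd (negbTE ev) expr0.
by move=> e; rewrite (_ : 2%:R = 1 + 1) // {1}e addNr.
Qed.

Theorem theorem6p3 (F : finFieldType) (mu : F) :
  (8 <= #|F|)%N -> ~~ odd #|F| -> mu != 0 -> mu != 1 ->
  (* quantities attached to a line of O_mu *)
  (forall L, L \in orbitO mu ->
     [/\ Pi_cnt (@is_Gamma_plane F) L = 0%N,
         P_cnt (@C_point F) L = 0%N &
         P_cnt (@T_point F) L = 2%N] /\
     [/\
         ((P_cnt (muGamma_point 3) L)%:R : rat) = (#|F|%:R - 3 - (N1 mu)%:R) / 3,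
         P_cnt (muGamma_point 1) L = N1 mu &
         ((P_cnt (muGamma_point 0) L)%:R : rat) = 2%:R * (#|F|%:R - (N1 mu)%:R) / 3] /\
     [/\
           Pi_cnt (dC_plane 2) L = 2%N,
           ((Pi_cnt (dC_plane 3) L)%:R : rat) = (#|F|%:R - 3 - (N1t mu)%:R) / 3,
           Pi_cnt (@onebar_plane F) L = N1t mu &
           ((Pi_cnt (dC_plane 0) L)%:R : rat) = 2%:R * (#|F|%:R - (N1t mu)%:R) / 3]) /\
  (* quantities attached to points *)
  (forall X, C_point X -> L_cnt (orbitO mu) X = 0%N) /\
  (forall X, T_point X -> L_cnt (orbitO mu) X = (#|F| - 1)%N) /\
  (forall X, muGamma_point 3 X ->
     ((L_cnt (orbitO mu) X)%:R : rat) = #|F|%:R - 3 - (N1 mu)%:R) /\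
  (forall X, muGamma_point 1 X -> L_cnt (orbitO mu) X = N1 mu) /\
  (forall X, muGamma_point 0 X ->
     ((L_cnt (orbitO mu) X)%:R : rat) = #|F|%:R - (N1 mu)%:R) /\
  (* quantities attached to planes *)
  (forall Y, is_Gamma_plane Y -> Lambda_cnt (orbitO mu) Y = 0%N) /\
  (forall Y, dC_plane 2 Y -> Lambda_cnt (orbitO mu) Y = (#|F| - 1)%N) /\
  (forall Y, dC_plane 3 Y ->
     ((Lambda_cnt (orbitO mu) Y)%:R : rat) = #|F|%:R - 3 - (N1t mu)%:R) /\
  (forall Y, onebar_plane Y -> Lambda_cnt (orbitO mu) Y = N1t mu) /\
  (forall Y, dC_plane 0 Y ->
     ((Lambda_cnt (orbitO mu) Y)%:R : rat) = #|F|%:R - (N1t mu)%:R).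
Proof.
move=> q8 /even_two0 two0 mu0 mu1.
have nu0 : mu^-1 != 0 by rewrite invr_eq0.
have nu1 : mu^-1 != 1 by rewrite invr_eq1.
rewrite (N1t_N1 two0 mu0).
have ptP (Q : pred 'M[F]_4) k P :
    (forall P, Q P -> is_point P) -> (forall X, X != 0 -> Q (ppt X) = ctype k X) ->
    Q P -> (L_cnt (orbitO mu) P * 2 = stab_size F k * ntype k mu)%N.
  move=> Qpt QE QP; have [X X0 PE] := is_pointP (Qpt P QP).
  by rewrite PE; apply: (L_cnt_orbit two0 q8 mu0 mu1); rewrite -QE // -PE.
have plP (Q : pred 'M[F]_4) k Y :
    (forall Y, Q Y -> is_plane Y) -> (forall X, X != 0 -> Q (pl X) = ctype k X) ->
    Q Y -> (Lambda_cnt (orbitO mu) Y * 2 = stab_size F k * ntype k mu^-1)%N.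
  move=> Qpl QE QY; have [X X0 YE] := is_planeP (Qpl Y QY).
  by rewrite YE; apply: (Lambda_cnt_orbit two0 q8 mu0 mu1); rewrite -QE // -YE.
have Tpt (P : 'M[F]_4) : T_point P -> is_point P by case/and3P.
have mupt k (P : 'M[F]_4) : muGamma_point k P -> is_point P by case/and3P.
have dCpl k (Y : 'M[F]_4) : dC_plane k Y -> is_plane Y by case/andP.
have obpl (Y : 'M[F]_4) : onebar_plane Y -> is_plane Y by case/and3P.
have TE := T_point_ppt two0; have muE k := muGamma_ppt two0 k.
have dCE (k : nat) (X : 'M[F]_2) : X != 0 -> k != 1%N -> dC_plane k (pl X) = ctype k X 
  by move=> X0 k1; apply: (dC_pl two0).
have obE := onebar_pl two0.
(* The next four facts divide the stabiliser orders 2, [#|F|.-1], 6 and 3 (forms with 1, 2, 3 and 0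
   zeros) by the order 2 of the line stabiliser. *)
have twice (a b : nat) : (a * 2 = 2 * b)%N -> a = b by lia.
have twice_q (a : nat) : (a * 2 = #|F|.-1 * 2)%N -> a = (#|F| - 1)%N by lia.
have from6 (n a : nat) (x : rat) : (n * 2 = 6 * a)%N -> a%:R = x / 3 -> n%:R = x.
  by move=> e e'; rewrite (_ : n = 3 * a)%N ?natrM ?e'; [field | lia].
have from3 (n a : nat) (x : rat) : (n * 2 = 3 * a)%N -> a%:R = 2%:R * x / 3 -> n%:R = x.
  by move=> e e'; apply: (@mulIf _ 2%:R) => //; rewrite -natrM e natrM e'; field.
split.
  move=> L LO; split; first split.
  - apply/eqP; rewrite cards_eq0; apply/eqP/setP => Y; rewrite !inE.
    apply/andP => -[GY]; by rewrite (Gamma_plane_notin two0 q8 mu0 mu1 LO GY).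
  - apply/eqP; rewrite cards_eq0; apply/eqP/setP => P; rewrite !inE.
    apply/andP => -[CP]; by rewrite (C_point_notin two0 q8 mu0 mu1 LO CP).
  - by rewrite (P_cnt_orbit two0 q8 Tpt TE LO) ntype2.
  split; split.
  - by rewrite (P_cnt_orbit two0 q8 (mupt 3) (muE 3) LO) ntype3_rat.
  - by rewrite (P_cnt_orbit two0 q8 (mupt 1) (muE 1) LO) ntype1.
  - by rewrite (P_cnt_orbit two0 q8 (mupt 0) (muE 0) LO) ntype0_rat.
  - by rewrite (Pi_cnt_orbit two0 q8 mu0 (dCpl 2) (fun X X0 => dCE 2 X X0 isT) LO) ntype2.
  - by rewrite (Pi_cnt_orbit two0 q8 mu0 (dCpl 3) (fun X X0 => dCE 3 X X0 isT) LO) ntype3_rat.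
  - by rewrite (Pi_cnt_orbit two0 q8 mu0 obpl obE LO) ntype1.
  - by rewrite (Pi_cnt_orbit two0 q8 mu0 (dCpl 0) (fun X X0 => dCE 0 X X0 isT) LO) ntype0_rat.
split.
  move=> P CP; apply/eqP; rewrite cards_eq0; apply/eqP/setP => L; rewrite !inE.
  apply/andP => -[LO]; rewrite (C_point_notin two0 q8 mu0 mu1 _ CP) //.
  by rewrite inE.
split; first by move=> P /(ptP _ _ _ Tpt TE); rewrite ntype2 //; apply: twice_q.
split.
  by move=> P /(ptP _ _ _ (mupt 3) (muE 3)) e; apply: from6 e _; apply: ntype3_rat.
split; first by move=> P /(ptP _ _ _ (mupt 1) (muE 1)) e; rewrite -ntype1 //; apply: twice.
split.
  by move=> P /(ptP _ _ _ (mupt 0) (muE 0)) e; apply: from3 e _; apply: ntype0_rat.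
split.
  move=> Y GY; apply/eqP; rewrite cards_eq0; apply/eqP/setP => L; rewrite !inE.
  apply/andP => -[LO]; rewrite (Gamma_plane_notin two0 q8 mu0 mu1 _ GY) //.
  by rewrite inE.
split.
  move=> Y /(plP _ _ _ (dCpl 2) (fun X X0 => dCE 2 X X0 isT)).
  by rewrite ntype2 //; apply: twice_q.
split.
  move=> Y /(plP _ _ _ (dCpl 3) (fun X X0 => dCE 3 X X0 isT)) e.
  by apply: from6 e _; apply: ntype3_rat.
split; first by move=> Y /(plP _ _ _ obpl obE) e; rewrite -ntype1 //; apply: twice.
move=> Y /(plP _ _ _ (dCpl 0) (fun X X0 => dCE 0 X X0 isT)) e.
by apply: from3 e _; apply: ntype0_rat.
Qed.
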